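(* Let $\rho,\mu\in\mathcal P(\mathbb R^d\times\mathcal I)$ and let $P\in\mathcal P(\Omega_T)$ be the law of the reference regime-switching process. Assume: (1) $H(\rho\otimes\mu\mid P_{0,T})<\infty$ and $P_{0,T}\big|_{\operatorname{supp}(\rho\otimes\mu)}\ll\rho\otimes\mu$. (2) For every $i,j\in\mathcal I$ with $\bar\rho(i)>0$ and $\bar\mu(j)>0$, the conditional laws $\hat\rho_i$ and $\hat\mu_j$ are absolutely continuous with respect to the Lebesgue measure on $\mathbb R^d$. (3) $\rho$ and $\mu$ are compactly supported on $\mathbb R^d\times\mathcal I$. (4) There is a constant $C_\mu>0$ such that $W_2^2(\eta,\hat\mu_i)\le C_\mu H(\eta\mid\hat\mu_i)$ for all $i\in\mathcal I$ with $\bar\mu(i)>0$ and all $\eta\in\mathcal P(\mathbb R^d)$. (5) The transition kernel of the reference process admits a density $r_{ij}(0,x;T,y)$, and for every $i,j\in\mathcal I$ with $\bar\rho(i)\bar\mu(j)>0$ the map $(x,y)\mapsto r_{ij}(0,x;T,y)$ is of class $C^2$ and strictly positive on $\operatorname{supp}(\hat\rho_i)\times\operatorname{supp}(\hat\mu_j)$. Let $\pi^{\rho,\mu}$ be the unique optimal coupling, and let $\pi^{n+1,n}$, $\pi^{n+1,n+1}$ ($n\ge0$) be the half-step and full-step couplings generated by the Sinkhorn iteration from a strictly positive initial family $g^0=(g^0_j)_{j\in\mathcal I}$. Assume $H(\pi^{\rho,\mu}\mid\pi^{1,0})<\infty$ and $H(\pi^{\rho,\mu}\mid\pi^{1,1})<\infty$.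 Then there exist constants $C>0$ and $\theta\in(0,1)$, depending on $\rho,\mu,P$ and $\pi^{1,0},\pi^{1,1}$, such that for all $n\ge0$ $$H(\pi^{\rho,\mu}\mid\pi^{n+1,n})\le C\theta^n,\qquad H(\pi^{\rho,\mu}\mid\pi^{n+1,n+1})\le C\theta^n.$$
   Context: Fix $T>0$, $d\ge1$, a finite set $\mathcal I=\{1,\dots,m\}$, and $E:=\mathbb R^d\times\mathcal I$. Reference process: $Z_t=(X_t,I_t)$, $t\in[0,T]$, is an $E$-valued Markov process with $dX_t=b_{I_t}(t,X_t)\,dt+\sigma_{I_t}(t,X_t)\,dW_t$ ($W$ a $d$-dimensional Brownian motion) and $\mathbb P(I_{t+h}=j\mid I_t=i,X_t=x)=\lambda_{ij}(t,x)h+o(h)$ as $h\downarrow0$ for $j\ne i$, where $b_i:[0,T]\times\mathbb R^d\to\mathbb R^d$, $\sigma_i:[0,T]\times\mathbb R^d\to\mathbb R^{d\times d}$, $\lambda_{ij}:[0,T]\times\mathbb R^d\to\mathbb R_+$ (jumps change only $I$, not $X$). $P$ is its law on $\Omega_T=C([0,T];\mathbb R^d)\times D([0,T];\mathcal I)$ and $P_{0,T}:=P\circ(Z_0,Z_T)^{-1}$. It is assumed that the components $A\mapsto P(X_0\in A,I_0=i)$ of the initial law have Lebesgue densities, and the transition density $r_{ij}$ is defined by $P(X_T\in dy,I_T=j\mid X_0=x,I_0=i)=r_{ij}(0,x;T,y)\,dy$. For a measure $\eta$ on $E$: $\eta_i(A):=\eta(A\times\{i\})$, $\bar\eta(i):=\eta_i(\mathbb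 R^d)$, and, if $\bar\eta(i)>0$, $\hat\eta_i:=\eta_i/\bar\eta(i)$. For a measure $\pi$ on $E\times E$, $\pi_{ij}(A\times B):=\pi((A\times\{i\})\times(B\times\{j\}))$. $H(\alpha\mid\beta)=\int\log\frac{d\alpha}{d\beta}\,d\alpha$ if $\alpha\ll\beta$, $+\infty$ otherwise. $W_2$ is the quadratic Wasserstein distance. $\Pi(\rho,\mu)$ is the set of couplings of $\rho$ and $\mu$. Optimal coupling: with $c((x,i),(y,j)):=c_{ij}(x,y):=-\log r_{ij}(0,x;T,y)$, $\pi^{\rho,\mu}$ is the unique minimizer over $\pi\in\Pi(\rho,\mu)$ of $H(\pi\mid\rho\otimes\mu)+\int c\,d\pi$ (equivalently of $H(\pi\mid P_{0,T})$). Sinkhorn iteration: given strictly positive $g^0=(g_j^0)_{j\in\mathcal I}$, for $n\ge0$ $$f_i^{n+1}(x)=\Bigl(\sum_{j\in\mathcal I}\int_{\mathbb R^d}r_{ij}(0,x;T,y)g_j^n(y)\,\mu_j(dy)\Bigr)^{-1},\qquad g_j^{n+1}(y)=\Bigl(\sum_{i\in\mathcal I}\int_{\mathbb R^d}r_{ij}(0,x;T,y)f_i^{n+1}(x)\,\rho_i(dx)\Bigr)^{-1}.$$ Couplings: $$\pi_{ij}^{n+1,n}(dx,dy)=f_i^{n+1}(x)r_{ij}(0,x;T,y)g_j^n(y)\,\rho_i(dx)\mu_j(dy),$$ $$\pi_{ij}^{n+1,n+1}(dx,dy)=f_i^{n+1}(x)r_{ij}(0,x;T,y)g_j^{n+1}(y)\,\rho_i(dx)\mu_j(dy).$$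 *)

(* Defs.v *)
From HB Require Import structures.
From mathcomp Require Import all_boot all_order all_algebra.
From mathcomp Require Import all_classical all_reals all_analysis.
From mathcomp Require Import measurable_realfun.

Set Implicit Arguments.
Unset Strict Implicit.
Unset Printing Implicit Defensive.
Import Order.TTheory GRing.Theory Num.Theory.
Import numFieldNormedType.Exports.

Local Open Scope classical_set_scope.
Local Open Scope ring_scope.

(** [R^d] is ['rV[R]_d] with its Borel sigma-algebra.  The regimes are
['I_m.+1], an arbitrary non-empty finite set, with the discrete topology and
the discrete sigma-algebra. *)

Section borel_matrix.
Context (R : realType) (p q : nat).

HB.instance Definition _ :=
  @isMeasurable.Build default_measure_display 'M[R]_(p, q)
    <<s @open 'M[R]_(p, q) >> (@sigma_algebra0 _ setT open)
    (@sigma_algebraC _ open) (@sigma_algebra_bigcup _ setT open).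

End borel_matrix.

Section regimes.
Context (m : nat).

HB.instance Definition _ := isPointed.Build 'I_m.+1 ord0.
HB.instance Definition _ := hasNbhs.Build 'I_m.+1 principal_filter.
HB.instance Definition _ := Discrete_ofNbhs.Build 'I_m.+1 erefl.
HB.instance Definition _ := DiscreteUniform_ofNbhs.Build 'I_m.+1.
HB.instance Definition _ :=
  @isMeasurable.Build default_measure_display 'I_m.+1
    discrete_measurable discrete_measurable0
    discrete_measurableC discrete_measurableU.

End regimes.

Notation state R d m := ('rV[R]_d * 'I_m.+1)%type.

(** Lebesgue measure on [R^d], by iterated integration of sections. *)
Fixpoint lebesgue_rV (R : realType) (d : nat) : set 'rV[R]_d -> \bar R :=
  match d with
  | 0 => fun A => \d_(0 : 'rV[R]_0) A
  | d'.+1 => fun A =>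
      (\int[lebesgue_measure]_t
         lebesgue_rV [set v : 'rV[R]_d' |
                      A (row_mx (const_mx t : 'rV[R]_1) v : 'rV[R]_(1 + d'))])%E
  end.

(** Measures are passed as set functions [set T -> \bar R] where the definition
makes sense at that generality. *)

Section measures.
Context (R : realType).

Definition topological_support (T : topologicalType) (eta : set T -> \bar R) :
    set T :=
  [set x | forall U, open U -> U x -> (0 < eta U)%E].

Section entropy.
Context d (T : measurableType d).
Implicit Types alpha beta : set T -> \bar R.

Definition is_density alpha beta (h : T -> \bar R) : Prop :=
  [/\ forall x, (0 <= h x)%E, measurable_fun setT h &
      forall A, measurable A -> alpha A = (\int[beta]_(x in A) h x)%E].

(** The default value [+oo] of the derivative is only taken if [alpha] has no
density with respect to [beta], which by Radon-Nikodym cannot happen for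
sigma-finite measures [alpha `<< beta]. *)
Definition derivative_of alpha beta : T -> \bar R :=
  xget (cst +oo%E) (is_density alpha beta).

Definition rel_entropy alpha beta : \bar R :=
  if `[< alpha `<< beta >]
  then (\int[alpha]_x lne (derivative_of alpha beta x))%E else +oo%E.

End entropy.

Definition is_coupling d1 d2 (T1 : measurableType d1) (T2 : measurableType d2)
    (eta1 : set T1 -> \bar R) (eta2 : set T2 -> \bar R)
    (gamma : set (T1 * T2) -> \bar R) : Prop :=
  (forall A, measurable A -> gamma (A `*` setT) = eta1 A) /\
  (forall B, measurable B -> gamma (setT `*` B) = eta2 B).

Section components.
Context (d m : nat).
Implicit Type eta : set (state R d m) -> \bar R.

Definition component eta (i : 'I_m.+1) : set 'rV[R]_d -> \bar R :=
  fun A => eta (A `*` [set i]).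

Definition regime_mass eta (i : 'I_m.+1) : \bar R := component eta i setT.

Definition conditional_law eta (i : 'I_m.+1) : set 'rV[R]_d -> \bar R :=
  fun A => (component eta i A * (regime_mass eta i)^-1)%E.

End components.

(** The norm of ['rV[R]_d] in the library is the sup norm, hence the explicit
Euclidean cost. *)
Definition wasserstein2 (d : nat) (eta nu : set 'rV[R]_d -> \bar R) : \bar R :=
  (ereal_inf [set (\int[gamma]_z (\sum_(k < d) (z.1 0 k - z.2 0 k) ^+ 2)%:E)%E
             | gamma in [set gamma : probability ('rV[R]_d * 'rV[R]_d)%type R |
                         is_coupling eta nu gamma]] `^ 2^-1)%E.

End measures.

Section C2.
Context (R : realType) (V : normedModType R).
Implicit Types (f : V -> R) (U S : set V).

Definition C2_open f U : Prop :=
  [/\ forall x, U x -> {for x, continuous f},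
      forall v x, U x ->
        derivable (f : V -> R^o) x v /\
        {for x, continuous (derive (f : V -> R^o) ^~ v)} &
      forall v w x, U x ->
        derivable (derive (f : V -> R^o) ^~ v) x w /\
        {for x, continuous (derive (derive (f : V -> R^o) ^~ v) ^~ w)}].

(** On a set that need not be open, [f] is C^2 if it is locally the restriction
of a C^2 function. *)
Definition C2_on f S : Prop :=
  forall x, S x -> exists (U : set V) (g : V -> R),
    [/\ open U, U x, C2_open g U & {in U `&` S, f =1 g}].

End C2.

(** Path space [C([0,T]; R^d) * D([0,T]; I)]: a path is given by a function on [R] of which only the values on [[0, T]]
matter: the sigma-algebras are generated by the evaluations at the times of
[[0, T]]. *)

Section paths.
Context (R : realType) (d m : nat) (T : R).

Record cpath := CPath {
  cpath_fun :> R -> 'rV[R]_d ;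
  cpath_continuous : {within `[0, T], continuous cpath_fun} }.

Record dpath := DPath {
  dpath_fun :> R -> 'I_m.+1 ;
  dpath_right : forall t, 0 <= t < T -> dpath_fun s @[s --> t^'+] --> dpath_fun t ;
  dpath_left : forall t, 0 < t <= T -> cvg (dpath_fun s @[s --> t^'-]) }.

HB.instance Definition _ := gen_eqMixin cpath.
HB.instance Definition _ := gen_choiceMixin cpath.
HB.instance Definition _ := gen_eqMixin dpath.
HB.instance Definition _ := gen_choiceMixin dpath.

Lemma cst_cpath : {within `[0, T], continuous (cst (0 : 'rV[R]_d))}.
Proof. by apply: continuous_subspaceT => x; exact: cst_continuous. Qed.

Lemma cst_dpath_right t : 0 <= t < T ->
  (cst ord0 : R -> 'I_m.+1) s @[s --> t^'+] --> (ord0 : 'I_m.+1).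
Proof. by move=> _; exact: cvg_cst. Qed.

Lemma cst_dpath_left t : 0 < t <= T ->
  cvg ((cst ord0 : R -> 'I_m.+1) s @[s --> t^'-]).
Proof. by move=> _; exact: is_cvg_cst. Qed.

HB.instance Definition _ := isPointed.Build cpath (CPath cst_cpath).
HB.instance Definition _ :=
  isPointed.Build dpath (DPath cst_dpath_right cst_dpath_left).

Definition cpath_cylinder : set (set cpath) :=
  [set C | exists t (A : set 'rV[R]_d),
    [/\ 0 <= t <= T, measurable A & C = [set x : cpath | A (x t)]]].

Definition dpath_cylinder : set (set dpath) :=
  [set C | exists t (A : set 'I_m.+1),
    [/\ 0 <= t <= T, measurable A & C = [set x : dpath | A (x t)]]].

HB.instance Definition _ :=
  @isMeasurable.Build default_measure_display cpath
    <<s cpath_cylinder >> (@sigma_algebra0 _ setT cpath_cylinder)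
    (@sigma_algebraC _ cpath_cylinder)
    (@sigma_algebra_bigcup _ setT cpath_cylinder).

HB.instance Definition _ :=
  @isMeasurable.Build default_measure_display dpath
    <<s dpath_cylinder >> (@sigma_algebra0 _ setT dpath_cylinder)
    (@sigma_algebraC _ dpath_cylinder)
    (@sigma_algebra_bigcup _ setT dpath_cylinder).

Definition path_space := (cpath * dpath)%type.

Definition canonical_process (t : R) (w : path_space) : state R d m := (w.1 t, w.2 t).

End paths.

Section stochastic_calculus.
Context (R : realType) (dO : measure_display) (O : measurableType dO).
Context (Q : probability O R) (T : R).
Implicit Types (F : R -> set (set O)).

Definition is_filtration F : Prop :=
  [/\ forall t, 0 <= t <= T -> sigma_algebra setT (F t),
      forall t, 0 <= t <= T -> F t `<=` measurable &
      forall s t, 0 <= s -> s <= t -> t <= T -> F s `<=` F t].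

Definition adapted F dE (E : measurableType dE) (Y : R -> O -> E) : Prop :=
  forall t, 0 <= t <= T -> forall A, measurable A -> F t (Y t @^-1` A).

Definition progressive F (H : R -> O -> R) : Prop :=
  forall t, 0 <= t <= T ->
    measurable_fun (`[0, t] `*` setT)
      (fun q : R * g_sigma_algebraType (F t) => H q.1 q.2).

Definition cvg_in_probability (Y : nat -> O -> \bar R) : Prop :=
  forall e : R, 0 < e -> Q [set w | (e%:E <= `|Y n w|)%E] @[n --> \oo] --> 0%E.

(** [d]-dimensional Brownian motion relative to [F]: the increment over
[[s, t]] is independent of [F s] and its coordinates are independent with law
N(0, t - s). *)
Definition is_brownian F (d : nat) (W : R -> O -> 'rV[R]_d) : Prop :=
  [/\ adapted F W,
      {ae Q, forall w, W 0 w = 0},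
      {ae Q, forall w, {within `[0, T], continuous (W ^~ w)}} &
      forall s t, 0 <= s -> s < t -> t <= T ->
      forall (B : set O) (A : 'I_d -> set R), F s B ->
        (forall k, measurable (A k)) ->
        Q (B `&` [set w | forall k, A k (W t w 0 k - W s w 0 k)]) =
        (Q B * \prod_(k < d) normal_prob 0 (Num.sqrt (t - s)) (A k))%E].

(** A simple process [sum_k xi_k 1_(]s_k, t_k])] is given by the list of the
triples [(s_k, t_k, xi_k)]. *)
Definition simple_process := seq (R * R * (O -> R)).

Definition is_simple F (S : simple_process) : Prop :=
  forall n, (n < size S)%N ->
  let: (s, t, xi) := nth (0, 0, cst 0) S n in
  [/\ 0 <= s, s <= t, t <= T,
      (exists M : R, forall w, `|xi w| <= M) &
      forall A, measurable A -> F s (xi @^-1` A)].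

Definition simple_value (S : simple_process) (u : R) (w : O) : R :=
  \sum_(q <- S) q.2 w * (if q.1.1 < u <= q.1.2 then 1 else 0).

Definition simple_integral (W : R -> O -> R) (S : simple_process)
    (u : R) (w : O) : R :=
  \sum_(q <- S)
    q.2 w * (W (Num.min q.1.2 u) w - W (Num.min q.1.1 u) w).

(** [M u] is the Ito integral of [H] with respect to [W] over [[0, u]]. *)
Definition is_ito_integral F (W H M : R -> O -> R) : Prop :=
  [/\ progressive F H,
      {ae Q, forall w,
        (\int[lebesgue_measure]_(s in `[0%R, T]) ((H s w) ^+ 2)%:E < +oo)%E},
      forall u, 0 <= u <= T -> measurable_fun setT (M u) &
      exists S : nat -> simple_process,
      [/\ forall n, is_simple F (S n),
          cvg_in_probability (fun n w =>
            \int[lebesgue_measure]_(s in `[0%R, T])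
              ((simple_value (S n) s w - H s w) ^+ 2)%:E)%E &
          forall u, 0 <= u <= T ->
            cvg_in_probability (fun n w =>
              (simple_integral W (S n) u w - M u w)%:E)]].

End stochastic_calculus.

Section reference_process.
Context (R : realType) (d m : nat) (T : R).
Local Notation E := (state R d m).
Local Notation Omega := (path_space d m T).
Implicit Types (P : probability Omega R)
  (b : 'I_m.+1 -> R -> 'rV[R]_d -> 'rV[R]_d)
  (sigma : 'I_m.+1 -> R -> 'rV[R]_d -> 'M[R]_d)
  (lambda : 'I_m.+1 -> 'I_m.+1 -> R -> 'rV[R]_d -> R)
  (p : R -> R -> R.-pker E ~> E)
  (r : 'I_m.+1 -> 'I_m.+1 -> 'rV[R]_d -> 'rV[R]_d -> R).

(** [P] is the law of a weak solution of
[dX_t = b_(I_t)(t, X_t) dt + sigma_(I_t)(t, X_t) dW_t]. *)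
Definition law_of_sde_solution P b sigma : Prop :=
  exists (dO : measure_display) (O : measurableType dO) (Q : probability O R)
    (F : R -> set (set O)) (W : R -> O -> 'rV[R]_d) (Z : O -> Omega),
  let X t w := (Z w).1 t in
  let I t w := (Z w).2 t in
  [/\ is_filtration T F, is_brownian Q T F W &
    [/\ measurable_fun setT Z, adapted T F X, adapted T F I,
        (forall A, measurable A -> P A = Q (Z @^-1` A)) &
    [/\ forall k, progressive T F (fun t w => b (I t w) t (X t w) 0 k),
        forall k, {ae Q, forall w,
          lebesgue_measure.-integrable `[0, T]
            (fun s => (b (I s w) s (X s w) 0 k)%:E)} &
        exists M : 'I_d -> 'I_d -> R -> O -> R,
          (forall k l, is_ito_integral Q T F (fun t w => W t w 0 l)
             (fun t w => sigma (I t w) t (X t w) k l) (M k l)) /\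
          (forall k t, 0 <= t <= T -> {ae Q, forall w,
             X t w 0 k = X 0 w 0 k
               + Rintegral lebesgue_measure `[0, t]
                   (fun s => b (I s w) s (X s w) 0 k)
               + \sum_(l < d) M k l t w})]]].

Definition past (s : R) : set (set Omega) :=
  <<s [set C | exists u (A : set E),
        [/\ 0 <= u <= s, measurable A & C = canonical_process u @^-1` A]] >>.

(** [p s t z A] is the probability of [Z_t \in A] given [Z_s = z]. *)
Definition is_markov P p : Prop :=
  forall s t, 0 <= s -> s <= t -> t <= T ->
  forall (B : set Omega) (A : set E), past s B -> measurable A ->
    P (B `&` canonical_process t @^-1` A) =
    (\int[P]_(w in B) p s t (canonical_process s w) A)%E.

Definition has_jump_rates p lambda : Prop :=
  forall i j, j != i ->
    (forall t x, 0 <= t <= T -> 0 <= lambda i j t x) /\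
    (forall t x, 0 <= t < T ->
       fine (p t (t + h) (x, i) (setT `*` [set j])) / h
         @[h --> 0^'+] --> lambda i j t x).

Definition initial_law P : set E -> \bar R :=
  fun A => P (canonical_process 0 @^-1` A).

Definition endpoint_law P : set (E * E) -> \bar R :=
  fun A => P [set w | A (canonical_process 0 w, canonical_process T w)].

Definition is_reference_process P p b sigma lambda : Prop :=
  [/\ law_of_sde_solution P b sigma, is_markov P p, has_jump_rates p lambda &
      forall i, exists h,
        is_density (component (initial_law P) i) (@lebesgue_rV R d) h].

Definition is_transition_density p r : Prop :=
  [/\ forall i j x y, 0 <= r i j x y,
      forall i j, measurable_fun setT
        (fun q : 'rV[R]_d * 'rV[R]_d => r i j q.1 q.2) &
      forall i j x (A : set 'rV[R]_d), measurable A ->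
        p 0 T (x, i) (A `*` [set j]) =
        (\int[@lebesgue_rV R d]_(y in A) (r i j x y)%:E)%E].

End reference_process.

Section sinkhorn.
Context (R : realType) (d m : nat).
Local Notation E := (state R d m).
Context (rho mu : probability E R).
Context (r : 'I_m.+1 -> 'I_m.+1 -> 'rV[R]_d -> 'rV[R]_d -> R).
Local Open Scope ereal_scope.

Definition cost (q : E * E) : \bar R :=
  - lne (r q.1.2 q.2.2 q.1.1 q.2.1)%:E.

Definition entropic_cost (pi : probability (E * E)%type R) : \bar R :=
  rel_entropy pi (rho \x mu) + \int[pi]_q cost q.

Definition is_optimal_coupling (pi : probability (E * E)%type R) : Prop :=
  is_coupling rho mu pi /\
  forall pi' : probability (E * E)%type R, is_coupling rho mu pi' ->
    entropic_cost pi <= entropic_cost pi'.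

(** Potentials take values in [[0, +oo]]; in [\bar R], [0^-1 = +oo] and
[+oo^-1 = 0]. *)
Definition potential := 'I_m.+1 -> 'rV[R]_d -> \bar R.

Definition sinkhorn_f (g : potential) : potential := fun i x =>
  (\sum_(j < m.+1) \int[component mu j]_y ((r i j x y)%:E * g j y))^-1.

Definition sinkhorn_g (f : potential) : potential := fun j y =>
  (\sum_(i < m.+1) \int[component rho i]_x ((r i j x y)%:E * f i x))^-1.

Fixpoint sinkhorn (g0 : potential) (n : nat) : potential :=
  if n is n'.+1 then sinkhorn_g (sinkhorn_f (sinkhorn g0 n')) else g0.

Definition plan (f g : potential) : set (E * E) -> \bar R := fun A =>
  \int[rho \x mu]_(q in A)
    (f q.1.2 q.1.1 * (r q.1.2 q.2.2 q.1.1 q.2.1)%:E * g q.2.2 q.2.1).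

(** [half_step g0 n] is [pi^(n+1,n)], [full_step g0 n] is [pi^(n+1,n+1)]. *)
Definition half_step (g0 : potential) (n : nat) : set (E * E) -> \bar R :=
  plan (sinkhorn_f (sinkhorn g0 n)) (sinkhorn g0 n).

Definition full_step (g0 : potential) (n : nat) : set (E * E) -> \bar R :=
  plan (sinkhorn_f (sinkhorn g0 n)) (sinkhorn g0 n.+1).

End sinkhorn.

(* Main.v *)
From HB Require Import structures.
Require Import Defs.
From mathcomp Require Import all_boot all_order all_algebra.
From mathcomp Require Import all_classical all_reals all_analysis.
From mathcomp Require Import measurable_realfun.
From mathcomp Require Import ring lra.

Set Implicit Arguments.
Unset Strict Implicit.
Unset Printing Implicit Defensive.
Import Order.TTheory GRing.Theory Num.Theory.
Import numFieldNormedType.Exports.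

Local Open Scope classical_set_scope.
Local Open Scope ring_scope.

(** The transition density [r] is continuous and positive on the product of the
two compact supports, so there [M^-1 <= r <= M] for some [M >= 1]
([kernel_bounded_on_support]), and the supports carry [rho] and [mu]
([topological_support_full]).  Everything else is about a kernel [k] on a
product of two probability spaces with [a <= k <= b] and [0 < a].

For such a kernel one Sinkhorn half-step [g |-> 1 / \int k g] contracts.  Since
[k] dominates [a] times a rank-one kernel, the oscillation of the quotient of
two potentials, measured projectively, shrinks by the factor [1 - a / b]
([scaling_osc], a simple form of the contraction theorem of Birkhoff and Hopf).
Hence the quotients of successive iterates tend to constants geometrically
([row_scaling_osc]).

The optimal coupling [pi] is then compared with a coupling built from the
iterate itself.  One marginal of a Sinkhorn plan [Q = f k g] is exact, and the density of the other one is the quotient of two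
successive iterates, so it is within [1 + O(e)] of [1], where [e] is the current
oscillation.  Scaling [Q] down slightly and adding the missing mass as a product
gives a genuine coupling [gamma] whose density with respect to [Q] is at most
[1 + O(e)] ([coupling_correction]).  For every coupling, the entropy relative to
[Q] is the entropic cost minus the integrals of [ln f] and [ln g] against [rho]
and [mu], which do not depend on the coupling.  As [pi] minimizes the entropic
cost, [H(pi | Q) <= H(gamma | Q) <= ln (1 + O(e)) = O(e)]
([optimal_entropy_le]).

The first half-step is special because [g0] may be unbounded: its entropy is
finite by assumption, which also forces [g0] to be integrable
([weight_of_finite_entropy]). *)

(** * Measures given by a density *)

Section weighted_measure.
Local Open Scope ereal_scope.
Context d (T : measurableType d) (R : realType).
Variables (beta : {measure set T -> \bar R}) (w : T -> \bar R).

Definition weighted_measure (w_ge0 : forall x, 0 <= w x)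
    (mw : measurable_fun setT w) (w_fin : \int[beta]_x w x < +oo)
    (A : set T) : \bar R := \int[beta]_(x in A) w x.

Hypotheses (w_ge0 : forall x, 0 <= w x) (mw : measurable_fun setT w)
  (w_fin : \int[beta]_x w x < +oo).
Local Notation nu := (weighted_measure w_ge0 mw w_fin).

Let weighted0 : nu set0 = 0.
Proof. exact: integral_set0. Qed.

Let weighted_ge0 A : 0 <= nu A.
Proof. exact: integral_ge0. Qed.

Let weighted_sigma_additive : semi_sigma_additive nu.
Proof.
move=> F mF tF mUF; rewrite /weighted_measure ge0_integral_bigcup//; last first.
  exact: measurable_funTS.
by apply: is_cvg_ereal_nneg_natsum_cond => n _ _; exact: integral_ge0.
Qed.

HB.instance Definition _ := isMeasure.Build _ _ _ nu
  weighted0 weighted_ge0 weighted_sigma_additive.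

Let weighted_finite : fin_num_fun nu.
Proof.
move=> A mA; rewrite ge0_fin_numE//; apply: le_lt_trans w_fin.
exact: ge0_subset_integral.
Qed.

HB.instance Definition _ := @Measure_isFinite.Build _ _ _ nu weighted_finite.

End weighted_measure.

Lemma measurable_lne (R : realType) : measurable_fun setT (@lne R).
Proof.
rewrite (_ : @lne R = fun x => if (x <= 0)%E then -oo%E else
    if x == +oo%E then +oo%E else (ln (fine x))%:E); last first.
  by apply/funext => -[r| |]//=; rewrite ?lee_fin ?leNye.
apply: measurable_fun_ifT => //; first exact: measurable_fun_lee.
apply: measurable_fun_ifT => //; first exact: measurable_fun_eqe.
by apply/measurable_EFinP; apply: measurableT_comp.
Qed.

(** * Densities and relative entropy *)

Section densities.
Local Open Scope ereal_scope.
Context d (T : measurableType d) (R : realType).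
Implicit Types (alpha beta : {finite_measure set T -> \bar R}).
Implicit Types (h : T -> \bar R).

Lemma bounded_integrable alpha (f : T -> R) (M : R) : measurable_fun setT f ->
  (forall x, `|f x| <= M)%R -> alpha.-integrable setT (EFin \o f).
Proof.
move=> mf fM; apply: measurable_bounded_integrable => //.
  by rewrite ltey_eq fin_num_measure.
exists M; split; first exact: num_real.
by move=> N MN x _ /=; exact: le_trans (fM x) (ltW MN).
Qed.

Lemma density_dominates alpha beta h :
  is_density alpha beta h -> alpha `<< beta.
Proof.
case=> h0 mh hE; apply/null_content_dominatesP => A mA bA.
by rewrite hE// null_set_integral//; exact: measurable_funTS.
Qed.

Lemma density_unique alpha beta h h' :
  is_density alpha beta h -> is_density alpha beta h' -> ae_eq beta setT h h'.
Proof.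
move=> [h0 mh hE] [h'0 mh' h'E]; apply: integral_ae_eq => //.
- apply/integrableP; split => //; under eq_integral do rewrite gee0_abs//.
  by rewrite -hE// ltey_eq fin_num_measure.
- by move=> E _ mE; rewrite -hE// -h'E.
Qed.

(** Any density agrees almost everywhere with the Radon-Nikodym derivative, for
which the change of variables is known. *)
Lemma change_of_density alpha beta h (f : T -> \bar R) A :
  is_density alpha beta h -> measurable A -> (forall x, 0 <= f x) ->
  measurable_fun setT f ->
  \int[alpha]_(x in A) f x = \int[beta]_(x in A) (f x * h x).
Proof.
move=> hd mA f0 mf; have ab := density_dominates hd.
rewrite -(Radon_Nikodym_SigmaFinite.change_of_variables ab)//; last first.
  exact: measurable_funTS.
pose g := Radon_Nikodym_SigmaFinite.f alpha beta.
have mg : measurable_fun setT g.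
  exact: measurable_int (Radon_Nikodym_SigmaFinite.f_integrable ab).
have gd : is_density alpha beta g.
  by split => //; [exact: Radon_Nikodym_SigmaFinite.f_ge0
    |exact: Radon_Nikodym_SigmaFinite.f_integral].
have [h0 mh _] := hd; have [g0 _ _] := gd.
apply: ge0_ae_eq_integral => //.
- by apply: measurable_funTS; exact: emeasurable_funM.
- by apply: measurable_funTS; exact: emeasurable_funM.
- by move=> x _; rewrite mule_ge0.
- by move=> x _; rewrite mule_ge0.
- have := density_unique gd hd.
  by apply: filterS => x /(_ I) gh _; rewrite -gh.
Qed.

Lemma density_gt0 alpha beta h : is_density alpha beta h ->
  {ae alpha, forall x, 0 < h x}.
Proof.
case=> h0 mh hE.
have mh0 : measurable [set x | h x = 0].
  by rewrite -[X in measurable X]setTI; exact: measurable_eqe.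
exists [set x | h x = 0]; split => //.
- by rewrite hE// integral0_eq.
- move=> x /= /negP; rewrite -leNgt => hx.
  by apply/eqP; rewrite eq_le hx h0.
Qed.

Lemma density_fin alpha beta h : is_density alpha beta h ->
  {ae alpha, forall x, h x \is a fin_num}.
Proof.
move=> hd; have [h0 mh hE] := hd.
have : {ae beta, forall x, setT x -> h x \is a fin_num}.
  apply: (@integrable_ae _ _ _ beta setT measurableT h).
  apply/integrableP; split => //; under eq_integral do rewrite gee0_abs//.
  by rewrite -hE// ltey_eq fin_num_measure.
case=> N [mN N0 sN]; exists N; split => //.
  by have /null_content_dominatesP := density_dominates hd; exact.
by move=> x hx; apply: sN => /= h1; apply: hx; exact: h1.
Qed.

(** The entropy is defined through a chosen density; two densities agree almost
everywhere, so any of them computes it. *)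
Lemma entropy_of_density alpha beta h : is_density alpha beta h ->
  rel_entropy alpha beta = \int[alpha]_x lne (h x).
Proof.
move=> hd; rewrite /rel_entropy; have ab := density_dominates hd.
case: asboolP => // _.
have hd' : is_density alpha beta (derivative_of alpha beta).
  by apply: xgetPex; exists h.
have [_ mh _] := hd; have [_ mh' _] := hd'.
apply: ae_eq_integral => //; [exact: measurableT_comp (@measurable_lne R) _
  |exact: measurableT_comp (@measurable_lne R) _|].
have := null_dominates_ae_eq measurableT ab (density_unique hd' hd).
by apply: filterS => x /(_ I) hx _; rewrite hx.
Qed.

Lemma entropy_lty_density alpha beta : rel_entropy alpha beta < +oo ->
  exists h, is_density alpha beta h.
Proof.
rewrite /rel_entropy; case: asboolP => // ab _.
have [h [h0 hf hi hE]] := radon_nikodym_sigma_finite ab.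
by exists h; split => //; exact: measurable_int hi.
Qed.

(** Against [alpha], the negative part of [lne h] has integral that of
[h * (lne h)^-] against [beta], and [- t * ln t <= 1] for [0 < t < 1]. *)
Lemma lne_density_neg alpha beta h : is_density alpha beta h ->
  \int[alpha]_x ((@lne R \o h)^\- x) < +oo.
Proof.
move=> hd; have [h0 mh _] := hd.
have mlh : measurable_fun setT (@lne R \o h).
  exact: measurableT_comp (@measurable_lne R) _.
rewrite (change_of_density hd)//; last exact: measurable_funeneg.
apply: (@le_lt_trans _ _ (\int[beta]_x 1)); last first.
  by rewrite integral_cst// mul1e ltey_eq fin_num_measure.
apply: ge0_le_integral => //.
- by move=> x _; rewrite mule_ge0.
- by apply: emeasurable_funM => //; exact: measurable_funeneg.
move=> x _ /=; rewrite funenegE /=.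
have [h1|h1] := leP 1 (h x).
  by rewrite max_r ?mul0e// oppe_le0 lne_ge0.
have hfin : h x \is a fin_num by rewrite ge0_fin_numE// (lt_trans h1)// ltry.
have [->|hx0] := eqVneq (h x) 0; first by rewrite mule0.
have hgt0 : (0 < fine (h x))%R by rewrite fine_gt0// lt0e hx0 h0 ltey_eq hfin.
rewrite max_l; last by rewrite leeNr oppe0 lne_le0 ltW.
rewrite -(fineK hfin) lne_EFin// -EFinN -EFinM lee_fin -lnV//.
rewrite -ler_pdivlMr// mul1r.
by rewrite (le_trans (ltW (ln_sublinear _)))// invr_gt0.
Qed.

(** By the previous bound, the integral that defines the entropy is never of the
form [+oo - oo], so finite entropy means integrability. *)
Lemma lne_density_integrable alpha beta h : is_density alpha beta h ->
  rel_entropy alpha beta < +oo -> alpha.-integrable setT (@lne R \o h).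
Proof.
move=> hd; rewrite (entropy_of_density hd) => ent; have [h0 mh _] := hd.
have mlh : measurable_fun setT (@lne R \o h).
  exact: measurableT_comp (@measurable_lne R) _.
have neg_lty := lne_density_neg hd.
have pos_lty : \int[alpha]_x ((@lne R \o h)^\+ x) < +oo.
  have negf : \int[alpha]_x ((@lne R \o h)^\- x) \is a fin_num.
    by rewrite ge0_fin_numE//; exact: integral_ge0.
  by move: ent; rewrite integralE lteBlDr// addye//; move: negf;
  rewrite fin_numE => /andP[].
apply/integrableP; split => //.
have -> : (fun x => `|(@lne R \o h) x|) =
    ((@lne R \o h)^\+ \+ (@lne R \o h)^\-) := fune_abse _.
rewrite ge0_integralD//; [exact: lte_add_pinfty|exact: measurable_funepos|
  exact: measurable_funeneg].
Qed.

Lemma tilted_density alpha beta h (w : T -> \bar R) (phi : T -> R)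
    (w0 : forall x, 0 <= w x) (mw : measurable_fun setT w)
    (wfin : \int[beta]_x w x < +oo) :
  measurable_fun setT phi -> {ae beta, forall x, w x = (expR (phi x))%:E} ->
  is_density alpha beta h ->
  is_density alpha (weighted_measure w0 mw wfin)
    (fun x => h x * (expR (- phi x))%:E).
Proof.
move=> mphi wE [h0 mh hE].
have mhe : measurable_fun setT (fun x => h x * (expR (- phi x))%:E).
  apply: emeasurable_funM => //; apply/measurable_EFinP.
  by apply: measurableT_comp => //; exact: measurableT_comp.
split => // [x|A mA]; first by rewrite mule_ge0// lee_fin expR_ge0.
rewrite (@change_of_density _ beta w)//; last first.
  by move=> x; rewrite mule_ge0// lee_fin expR_ge0.
rewrite hE//; apply: ge0_ae_eq_integral => //.
- exact: measurable_funTS.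
- by apply: measurable_funTS; exact: emeasurable_funM.
- by move=> x _; rewrite !mule_ge0// lee_fin expR_ge0.
- apply: filterS wE => x -> _.
  by rewrite -muleA -EFinM -expRD addNr expR0 mule1.
Qed.

(** The density with respect to [expR phi * beta] is the density with respect to
[beta] times [expR (- phi)], so the logarithms differ by [phi], which is
integrable because it is bounded. *)
Lemma tilted_entropy alpha beta (w : T -> \bar R) (phi : T -> R) (M : R)
    (w0 : forall x, 0 <= w x) (mw : measurable_fun setT w)
    (wfin : \int[beta]_x w x < +oo) :
  measurable_fun setT phi -> (forall x, `|phi x| <= M)%R ->
  {ae beta, forall x, w x = (expR (phi x))%:E} ->
  rel_entropy alpha beta < +oo ->
  rel_entropy alpha (weighted_measure w0 mw wfin) =
    rel_entropy alpha beta - \int[alpha]_x (phi x)%:E /\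
  rel_entropy alpha beta \is a fin_num.
Proof.
move=> mphi phiM wE ent; have [h hd] := entropy_lty_density ent.
have hint := lne_density_integrable hd ent; have [h0 mh _] := hd.
have mlh : measurable_fun setT (@lne R \o h) by exact: measurable_int hint.
have iphi : alpha.-integrable setT (EFin \o phi).
  exact: bounded_integrable phiM.
split; last by rewrite (entropy_of_density hd) integrable_fin_num.
rewrite (entropy_of_density (tilted_density w0 mw wfin mphi wE hd)).
rewrite (entropy_of_density hd).
rewrite -integralB//.
apply: ae_eq_integral => //.
- apply: measurableT_comp (@measurable_lne R) _; apply: emeasurable_funM => //.
  apply/measurable_EFinP.
  by apply: measurableT_comp => //; exact: measurableT_comp.
- by apply: emeasurable_funB => //; exact/measurable_EFinP.
have : {ae alpha, forall x, 0 < h x /\ h x \is a fin_num}.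
  by have := density_gt0 hd; have := density_fin hd; apply: filterS2 => x; split.
apply: filterS => x [hx hf] _; rewrite lneM ?lne_EFin ?expR_gt0//=.
- by rewrite expRK EFinN.
- by rewrite in_itv/= hx leey.
- by rewrite in_itv/= lte_fin expR_gt0 leey.
Qed.

End densities.

Section entropy_bounds.
Local Open Scope ereal_scope.
Context d (T : measurableType d) (R : realType).

Lemma entropy_le_ln (alpha : probability T R)
    (beta : {finite_measure set T -> \bar R}) h (K : R) :
  is_density alpha beta h -> (0 < K)%R -> (forall x, h x <= K%:E) ->
  rel_entropy alpha beta <= (ln K)%:E.
Proof.
move=> hd K0 hK; have [h0 mh _] := hd.
have lK x : lne (h x) <= (ln K)%:E.
  rewrite -lne_EFin// lee_lne//.
  - by rewrite in_itv/= h0 leey.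
  - by rewrite in_itv/= leey andbT lee_fin ltW.
have mlh : measurable_fun setT (@lne R \o h).
  exact: measurableT_comp (@measurable_lne R) _.
have icst (r : R) : \int[alpha]_x r%:E = r%:E.
  by rewrite integral_cst// [X in _ * X]probability_setT mule1.
have ent : rel_entropy alpha beta < +oo.
  rewrite (entropy_of_density hd) integralE.
  apply: (@le_lt_trans _ _ (\int[alpha]_x (`|ln K|%R)%:E)); last first.
    by rewrite icst ltry.
  rewrite -[leRHS]sube0 leeB ?integral_ge0//.
  apply: ge0_le_integral => //.
  - exact: measurable_funepos.
  - move=> x _; rewrite funeposE ge_max lee_fin normr_ge0 andbT /=.
    by rewrite (le_trans (lK x))// lee_fin ler_norm.
have := lne_density_integrable hd ent; rewrite (entropy_of_density hd) => hi.
rewrite -[leRHS]icst; apply: le_integral => //.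
exact: (@bounded_integrable _ _ _ _ (fun=> ln K) `|ln K|%R).
Qed.

End entropy_bounds.

(** * Couplings and their entropy *)

Section couplings.
Local Open Scope ereal_scope.
Context d1 d2 (X : measurableType d1) (Y : measurableType d2) (R : realType).
Variables (rho : probability X R) (mu : probability Y R).

Lemma product_measureT : (rho \x mu) setT = 1.
Proof.
rewrite -setXTT product_measure1E// -[RHS]mule1.
by rewrite -{1}(probability_setT rho) -(probability_setT mu).
Qed.

(** [rho \x mu] bundled with its structure of probability measure. *)
Definition product_probability : probability (X * Y)%type R :=
  HB.pack (rho \x mu)
    (Measure_isProbability.Build _ _ _ (rho \x mu) product_measureT).

Lemma coupling_of_density (h : X * Y -> R) :
  measurable_fun setT h -> (forall q, 0 <= h q)%R ->
  (forall x, \int[mu]_y (h (x, y))%:E = 1) ->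
  (forall y, \int[rho]_x (h (x, y))%:E = 1) ->
  exists gamma : probability (X * Y)%type R,
    is_coupling rho mu gamma /\
    is_density gamma (rho \x mu) (EFin \o h).
Proof.
move=> mh h0 hX hY.
have mEh : measurable_fun setT (EFin \o h) by exact/measurable_EFinP.
have Eh0 q : 0 <= (EFin \o h) q by rewrite lee_fin.
have hT : \int[(rho \x mu)]_q (EFin \o h) q = 1.
  rewrite fubini_tonelli1// /fubini_F; under eq_integral do rewrite /= hX.
  by rewrite integral_cst// mul1e; exact: probability_setT.
have hfin : \int[(rho \x mu)]_q (EFin \o h) q < +oo by rewrite hT ltry.
pose m := weighted_measure Eh0 mEh hfin.
pose gamma : probability (X * Y)%type R :=
  HB.pack m (Measure_isProbability.Build _ _ _ m hT).
exists gamma; split; last by split.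
have mpatch D : measurable D -> measurable_fun setT ((EFin \o h) \_ D).
  by move=> mD; apply/(measurable_restrictT _ mD); exact: measurable_funTS.
have patch0 D q : 0 <= ((EFin \o h) \_ D) q by rewrite patchE; case: ifP.
split=> [A mA|B mB].
- have mA' : measurable (A `*` @setT Y) by exact: measurableX.
  rewrite /= /m /weighted_measure integral_mkcond fubini_tonelli1//; last exact: mpatch.
  rewrite -[RHS]mul1e -[RHS](@integral_cst _ _ _ rho A mA 1) [RHS]integral_mkcond.
  apply: eq_integral => x _; rewrite /fubini_F patchE.
  case: ifPn => xA.
    under eq_integral do rewrite patchE ifT ?in_setX ?xA ?in_setT//.
    exact: hX.
  by under eq_integral do rewrite patchE ifN ?in_setX ?(negbTE xA)//; rewrite integral0.
- have mB' : measurable (@setT X `*` B) by exact: measurableX.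
  rewrite /= /m /weighted_measure integral_mkcond fubini_tonelli2//; last exact: mpatch.
  rewrite -[RHS]mul1e -[RHS](@integral_cst _ _ _ mu B mB 1) [RHS]integral_mkcond.
  apply: eq_integral => y _; rewrite /fubini_G patchE.
  case: ifPn => yB.
    under eq_integral do rewrite patchE ifT ?in_setX ?yB ?in_setT//.
    exact: hY.
  by under eq_integral do rewrite patchE ifN ?in_setX ?(negbTE yB) ?andbF//; rewrite integral0.
Qed.

Lemma integral_marginals (gamma : probability (X * Y)%type R)
    (f : X -> R) (g : Y -> R) (M : R) :
  is_coupling rho mu gamma ->
  measurable_fun setT f -> measurable_fun setT g ->
  (forall x, `|f x| <= M)%R -> (forall y, `|g y| <= M)%R ->
  \int[gamma]_q (f q.1 + g q.2)%:E =
    \int[rho]_x (f x)%:E + \int[mu]_y (g y)%:E.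
Proof.
move=> [c1 c2] mf mg fM gM.
have i1 : gamma.-integrable setT (EFin \o (fun q => f q.1)).
  by apply: (@bounded_integrable _ _ _ _ _ M) => //; exact: measurableT_comp.
have i2 : gamma.-integrable setT (EFin \o (fun q => g q.2)).
  by apply: (@bounded_integrable _ _ _ _ _ M) => //; exact: measurableT_comp.
under eq_integral do rewrite EFinD.
rewrite (@integralD _ _ _ gamma setT measurableT _ _ i1 i2).
congr (_ + _).
- rewrite -(@integral_pushforward _ _ _ _ _ fst measurable_fst gamma setT (EFin \o f))//.
  + apply: eq_measure_integral => A mA _; apply: etrans (c1 A mA).
    by congr (gamma _); apply/seteqP; split => -[x y] //= -[].
  + exact/measurable_EFinP.
- rewrite -(@integral_pushforward _ _ _ _ _ snd measurable_snd gamma setT (EFin \o g))//.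
  + apply: eq_measure_integral => A mA _; apply: etrans (c2 A mA).
    by congr (gamma _); apply/seteqP; split => -[x y] //= -[].
  + exact/measurable_EFinP.
Qed.

(** For a coupling [gamma], the tilt of the reference measure from [rho \x mu] to
the plan [w] changes the cost by the integrals of [f] and [g] against [rho] and
[mu], which do not depend on [gamma]: the minimizer of the cost also minimizes
the entropy relative to the plan.  It is compared with the coupling of density
[h], whose density relative to the plan is at most [1 + eps]. *)
Lemma optimal_entropy_le (pi : probability (X * Y)%type R)
    (lk : X * Y -> R) (f : X -> R) (g : Y -> R) (w : X * Y -> \bar R)
    (h : X * Y -> R) (M eps : R) :
  let phi q := (f q.1 + g q.2 + lk q)%R in
  is_coupling rho mu pi ->
  (forall gamma : probability (X * Y)%type R, is_coupling rho mu gamma ->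
    rel_entropy pi (rho \x mu) - \int[pi]_q (lk q)%:E <=
    rel_entropy gamma (rho \x mu) - \int[gamma]_q (lk q)%:E) ->
  measurable_fun setT lk -> measurable_fun setT f -> measurable_fun setT g ->
  (forall q, `|lk q| <= M)%R -> (forall x, `|f x| <= M)%R ->
  (forall y, `|g y| <= M)%R ->
  (forall q, 0 <= w q) -> measurable_fun setT w ->
  {ae (rho \x mu), forall q, w q = (expR (phi q))%:E} ->
  measurable_fun setT h -> (forall q, 0 <= h q)%R ->
  (forall x, \int[mu]_y (h (x, y))%:E = 1) ->
  (forall y, \int[rho]_x (h (x, y))%:E = 1) ->
  (0 <= eps)%R -> (forall q, h q <= (1 + eps) * expR (phi q))%R ->
  rel_entropy pi (fun A => \int[(rho \x mu)]_(q in A) w q) <= eps%:E.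
Proof.
move=> phi pic piopt mlk mf mg lkM fM gM w0 mw wE mh h0 hX hY eps0 hphi.
pose beta : {finite_measure set (X * Y)%type -> \bar R} := product_probability.
pose psi (q : X * Y) := (f q.1 + g q.2)%R.
have mpsi : measurable_fun setT psi.
  by apply: measurable_funD; exact: measurableT_comp.
have mphi : measurable_fun setT phi by exact: measurable_funD.
have phiM q : (`|phi q| <= M + M + M)%R.
  rewrite (le_trans (ler_normD _ _))// lerD//.
  by rewrite (le_trans (ler_normD _ _))// lerD.
have psiM q : (`|psi q| <= M + M)%R by rewrite (le_trans (ler_normD _ _))// lerD.
have eps1 : (0 < 1 + eps)%R by rewrite ltr_pwDl.
have expM q : (expR (phi q) <= expR (M + M + M))%R.
  by rewrite ler_expR (le_trans (ler_norm _)).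
have wE' : {ae beta, forall q, w q = (expR (phi q))%:E} := wE.
have wfin : \int[beta]_q w q < +oo.
  rewrite (ge0_ae_eq_integral _ _ (g := EFin \o (expR \o phi)))//; last 3 first.
  - by apply/measurable_EFinP; exact: measurableT_comp.
  - by move=> q _; rewrite lee_fin expR_ge0.
  - by apply: filterS wE' => q -> _.
  apply: (@le_lt_trans _ _ (\int[beta]_q (expR (M + M + M))%:E)).
    apply: ge0_le_integral => //.
    - by move=> q _; rewrite lee_fin expR_ge0.
    - by apply/measurable_EFinP; exact: measurableT_comp.
    - by move=> q _; rewrite lee_fin; exact: expM.
  rewrite integral_cst//.
  by rewrite lte_mul_pinfty ?lee_fin ?expR_ge0// ltey_eq fin_num_measure.
have [gamma [gc gd0]] := coupling_of_density mh h0 hX hY.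
have gd : is_density gamma beta (EFin \o h) := gd0.
have gent : rel_entropy gamma beta < +oo.
  apply: (@le_lt_trans _ _ (ln ((1 + eps) * expR (M + M + M)))%:E); last first.
    by rewrite ltry.
  apply: entropy_le_ln gd _ _; first by rewrite mulr_gt0// expR_gt0.
  by move=> q; rewrite lee_fin (le_trans (hphi q))// ler_wpM2l// ltW.
pose W : {finite_measure set (X * Y)%type -> \bar R} :=
  weighted_measure w0 mw wfin.
have gW : rel_entropy gamma W <= eps%:E.
  apply: (@le_trans _ _ (ln (1 + eps))%:E); last first.
    rewrite lee_fin; by apply: le_ln1Dx; rewrite (lt_le_trans _ eps0)// ltrN10.
  apply: entropy_le_ln (tilted_density w0 mw wfin mphi wE' gd) eps1 _.
  move=> q; rewrite /= -EFinM lee_fin expRN ler_pdivrMr ?expR_gt0//.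
have ilk (eta : probability (X * Y)%type R) :
    eta.-integrable setT (EFin \o lk) by exact: bounded_integrable lkM.
have lkfin (eta : probability (X * Y)%type R) :
    \int[eta]_q (lk q)%:E \is a fin_num.
  exact: integrable_fin_num (ilk eta).
pose m := \int[rho]_x (f x)%:E + \int[mu]_y (g y)%:E.
have phiE (eta : probability (X * Y)%type R) : is_coupling rho mu eta ->
    \int[eta]_q (phi q)%:E = m + \int[eta]_q (lk q)%:E.
  move=> ec; under eq_integral do rewrite EFinD.
  rewrite (@integralD _ _ _ eta setT measurableT (EFin \o psi))//.
- by congr (_ + _); exact: integral_marginals gM.
- exact: bounded_integrable psiM.
- exact: ilk.
have mfin : m \is a fin_num.
  rewrite fin_numD (integrable_fin_num measurableT (bounded_integrable rho mf fM)).
  by rewrite (integrable_fin_num measurableT (bounded_integrable mu mg gM)).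
have [gWE gfin] := tilted_entropy w0 mw wfin mphi phiM wE' gent.
have opt : rel_entropy pi beta - \int[pi]_q (lk q)%:E <=
    rel_entropy gamma beta - \int[gamma]_q (lk q)%:E := piopt _ gc.
have pent : rel_entropy pi beta < +oo.
  have := opt; rewrite leeBlDr//.
  move=> /le_lt_trans; apply; rewrite -(fineK gfin) -(fineK (lkfin gamma)).
  by rewrite -(fineK (lkfin pi)) -EFinB -EFinD ltry.
have [pWE pfin] := tilted_entropy w0 mw wfin mphi phiM wE' pent.
apply: le_trans gW.
rewrite [leLHS]pWE gWE !phiE//.
have := opt.
rewrite -[rel_entropy pi _](fineK pfin) -[rel_entropy gamma _](fineK gfin).
rewrite -(fineK (lkfin pi)) -(fineK (lkfin gamma)) -(fineK mfin).
rewrite -!(EFinN, EFinD) !lee_fin; lra.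
Qed.

End couplings.

(** * Contraction of a Sinkhorn half-step *)

Section oscillation.
Context (R : realType) (S : Type).

(** The exponential of Hilbert's projective distance between [u] and [v] is at
most [1 + e].  A projective notion is needed because Sinkhorn potentials are
determined only up to a multiplicative constant. *)
Definition osc_le (e : R) (u v : S -> R) : Prop :=
  exists2 m, 0 < m & forall x, m * u x <= v x <= m * (1 + e) * u x.

Lemma osc_le_trans e e' u v : (forall x, 0 < u x) -> e <= e' ->
  osc_le e u v -> osc_le e' u v.
Proof.
move=> u0 ee' [m m0 uv]; exists m => // x; have /andP[-> vx] /= := uv x.
by rewrite (le_trans vx)// ler_pM2r// ler_pM2l// lerD2l.
Qed.

End oscillation.

Definition weight d (T : measurableType d) (R : realType)
    (nu : probability T R) (g : T -> R) : Prop :=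
  [/\ measurable_fun setT g, forall y, 0 < g y &
      nu.-integrable setT (EFin \o g)].

Lemma measurable_transpose d1 d2 (X : measurableType d1)
    (Y : measurableType d2) (R : realType) (k : X -> Y -> R) :
  measurable_fun setT (fun z : X * Y => k z.1 z.2) ->
  measurable_fun setT (fun z : Y * X => k z.2 z.1).
Proof. by move=> mk; exact: (measurableT_comp mk (@measurable_swap _ _ Y X)). Qed.

Section scaling.
Context d1 d2 (X : measurableType d1) (Y : measurableType d2) (R : realType).
Variables (mu : probability Y R) (k : X -> Y -> R) (a b : R).
Hypotheses (mk : measurable_fun setT (fun q : X * Y => k q.1 q.2))
  (a_gt0 : 0 < a) (k_ge : forall x y, a <= k x y)
  (k_le : forall x y, k x y <= b).
Implicit Types (g : Y -> R) (x : X).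

(** The Sinkhorn half-step: the weight on [X] that makes the first marginal of
the plan exact when the weight on [Y] is [g]. *)
Definition scaling (g : Y -> R) (x : X) : R :=
  (\int[mu]_y (k x y * g y))^-1.

Let b_gt0 : 0 < b.
Proof. by rewrite (lt_le_trans a_gt0)// (le_trans (k_ge point point)). Qed.

Lemma Rintegral_gt0 g : weight mu g -> 0 < \int[mu]_y g y.
Proof.
move=> [mg g0 ig]; rewrite lt_neqAle Rintegral_ge0 ?andbT; last first.
  by move=> y _; exact: ltW.
apply/eqP => gI.
have mEg : measurable_fun setT (EFin \o g) by exact/measurable_EFinP.
have gI0 : (\int[mu]_y `|(EFin \o g) y| = 0)%E.
  under eq_integral do rewrite gee0_abs ?lee_fin ?ltW//.
  by rewrite -[LHS]fineK ?integrable_fin_num//= -/(Rintegral _ _ _) -gI.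
have [N [mN N0 sN]] := (ae_eq_integral_abs mu measurableT mEg).1 gI0.
have NT : N = setT.
  apply/seteqP; split => // y _; apply: sN => /= /(_ I) [].
  by apply/eqP; rewrite gt_eqF.
have := probability_setT mu; rewrite -NT N0 => /eqP.
by rewrite eq_sym onee_eq0.
Qed.

Lemma kernel_integrable g x : measurable_fun setT g -> (forall y, 0 <= g y) ->
  mu.-integrable setT (EFin \o g) ->
  mu.-integrable setT (EFin \o (fun y => k x y * g y)).
Proof.
move=> mg g0 ig.
apply: (@le_integrable _ _ _ mu setT measurableT _ (fun y => b%:E * (g y)%:E)%E).
- apply/measurable_EFinP; apply: measurable_funM => //.
  exact: (measurableT_comp mk (pair1_measurable x)).
- move=> y _ /=; rewrite lee_fin !ger0_norm.
  + by rewrite ler_wpM2r.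
  + by rewrite mulr_ge0// ltW//.
  + by rewrite mulr_ge0// (le_trans (ltW a_gt0)).
- exact: integrableZl.
Qed.

Lemma kernel_integral_bounds g x : measurable_fun setT g ->
  (forall y, 0 <= g y) -> mu.-integrable setT (EFin \o g) ->
  a * \int[mu]_y g y <= \int[mu]_y (k x y * g y) <= b * \int[mu]_y g y.
Proof.
move=> mg g0 ig.
have iZ c : mu.-integrable setT (EFin \o (fun y => c * g y)).
  exact: (integrableZl measurableT c ig).
rewrite -!RintegralZl//; apply/andP; split; apply: le_Rintegral => //.
- exact: kernel_integrable.
- by move=> y _; rewrite ler_wpM2r.
- exact: kernel_integrable.
- by move=> y _; rewrite ler_wpM2r.
Qed.

Lemma weight_bounds g x : weight mu g ->
  a * \int[mu]_y g y <= \int[mu]_y (k x y * g y) <= b * \int[mu]_y g y.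
Proof. by move=> [mg g0 ig]; apply: kernel_integral_bounds => // y; exact: ltW. Qed.

Lemma kernel_integral_gt0 g x : weight mu g -> 0 < \int[mu]_y (k x y * g y).
Proof.
move=> wg; have /andP[+ _] := weight_bounds x wg.
by apply: lt_le_trans; rewrite mulr_gt0// Rintegral_gt0.
Qed.

Lemma scaling_gt0 g x : weight mu g -> 0 < scaling g x.
Proof. by move=> wg; rewrite invr_gt0 kernel_integral_gt0. Qed.

Lemma scaling_bounds g : weight mu g -> exists lo hi, 0 < lo /\
  forall x, lo <= scaling g x <= hi.
Proof.
move=> wg; have G0 := Rintegral_gt0 wg.
pose B := Num.max b 1.
have B0 : 0 < B by rewrite lt_max ltr01 orbT.
exists (B * \int[mu]_y g y)^-1, (a * \int[mu]_y g y)^-1.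
split; first by rewrite invr_gt0 mulr_gt0.
move=> x; have /andP[l u] := weight_bounds x wg.
rewrite !lef_pV2 ?posrE ?kernel_integral_gt0 ?mulr_gt0// l andbT.
by rewrite (le_trans u)// ler_pM2r// le_max lexx.
Qed.

Lemma measurable_scaling g : weight mu g -> measurable_fun setT (scaling g).
Proof.
move=> wg; have [mg g0 ig] := wg.
have -> : scaling g = expR \o (fun x => - ln (\int[mu]_y (k x y * g y))).
  by apply/funext => x /=; rewrite expRN lnK// posrE kernel_integral_gt0.
apply: measurableT_comp => //; apply: measurableT_comp => //.
apply: measurableT_comp => //; apply: measurableT_comp => //.
have := @measurable_fun_fubini_tonelli_F _ _ X Y R mu
  (fun q => (k q.1 q.2 * g q.2)%:E); apply.
- apply/measurable_EFinP; apply: measurable_funM => //.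
  exact: measurableT_comp.
- by move=> q; rewrite lee_fin mulr_ge0 ?(ltW (g0 _))// (le_trans (ltW a_gt0)).
Qed.

Lemma scaling_weight (rho : probability X R) g :
  weight mu g -> weight rho (scaling g).
Proof.
move=> wg; have [lo [hi [lo0 gb]]] := scaling_bounds wg.
have ms := measurable_scaling wg; split => // [x|].
  exact: scaling_gt0.
apply: (@bounded_integrable _ _ _ _ _ hi) => // x.
by have /andP[l h] := gb x; rewrite ger0_norm// ltW// scaling_gt0.
Qed.

Lemma scaling_integral g x c : weight mu g -> 0 <= c ->
  (\int[mu]_y (c * (k x y * g y))%:E = (c / scaling g x)%:E)%E.
Proof.
move=> [mg g0 ig] c0; under eq_integral do rewrite EFinM.
have ik : mu.-integrable setT (EFin \o (fun y => k x y * g y)).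
  by apply: kernel_integrable => // y; exact: ltW.
rewrite (integralZl measurableT ik) /scaling invrK EFinM fineK//.
exact: integrable_fin_num.
Qed.

(** The values before inversion lie between the multiples by [a] and [b] of one
number, the integral of [g]; hence a bound on their quotient that does not
depend on [g]. *)
Lemma scaling_harnack g x x' : weight mu g -> a * scaling g x <= b * scaling g x'.
Proof.
move=> wg; have G0 := Rintegral_gt0 wg.
have /andP[l u] := weight_bounds x wg.
have /andP[l' u'] := weight_bounds x' wg.
rewrite /scaling ler_pdivlMr ?kernel_integral_gt0//.
rewrite mulrAC ler_pdivrMr ?kernel_integral_gt0//.
by rewrite (le_trans (ler_wpM2l (ltW a_gt0) u'))// mulrCA ler_wpM2l// ltW.
Qed.

(** The contraction: the kernel dominates [a] times a rank-one kernel, which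
maps [g] and [g'] to proportional functions, so only the remaining fraction
[1 - a / b] of the oscillation survives. *)
Lemma scaling_osc g g' e : weight mu g -> weight mu g' -> 0 <= e ->
  osc_le e g g' -> osc_le ((1 - a / b) * e) (scaling g) (scaling g').
Proof.
move=> wg wg' e0 [m m0 gg'].
have [mg g0 ig] := wg; have [mg' g'0 ig'] := wg'.
set M := m * (1 + e) in gg' *.
set G := \int[mu]_y g y; set G' := \int[mu]_y g' y.
have G0 : 0 < G by exact: Rintegral_gt0.
have iZ c : mu.-integrable setT (EFin \o (fun y => c * g y)).
  exact: (integrableZl measurableT c ig).
have iZ' c : mu.-integrable setT (EFin \o (fun y => c * g' y)).
  exact: (integrableZl measurableT c ig').
have igk x : mu.-integrable setT (EFin \o (fun y => k x y * g y)).
  by apply: kernel_integrable => // y; exact: ltW.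
have ik x c : mu.-integrable setT (EFin \o (fun y => c * (k x y * g y))).
  exact: (integrableZl measurableT c (igk x)).
have igk' x : mu.-integrable setT (EFin \o (fun y => k x y * g' y)).
  by apply: kernel_integrable => // y; exact: ltW.
have ik' x c : mu.-integrable setT (EFin \o (fun y => c * (k x y * g' y))).
  exact: (integrableZl measurableT c (igk' x)).
have comb p q x : (forall y, 0 <= p * g y + q * g' y) ->
    a * (p * G + q * G') <= p * \int[mu]_y (k x y * g y)
                            + q * \int[mu]_y (k x y * g' y).
  move=> pq0.
  have ipq : mu.-integrable setT (EFin \o (fun y => p * g y + q * g' y)).
    exact: (integrableD measurableT (iZ p) (iZ' q)).
  have mpq : measurable_fun setT (fun y => p * g y + q * g' y).
    by apply: measurable_funD; exact: measurable_funM.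
  have /andP[+ _] := kernel_integral_bounds x mpq pq0 ipq.
  have -> : \int[mu]_y (k x y * (p * g y + q * g' y)) =
      \int[mu]_y (p * (k x y * g y) + q * (k x y * g' y)).
    by apply: eq_Rintegral => y _; ring.
  by rewrite !RintegralD// !RintegralZl.
have lowB x : a * (G' - m * G) <=
    \int[mu]_y (k x y * g' y) - m * \int[mu]_y (k x y * g y).
  have := comb (- m) 1 x; rewrite !mulNr !mul1r addrC [leRHS]addrC; apply => y.
  by rewrite mulNr mul1r addrC subr_ge0; have /andP[] := gg' y.
have uppB x : a * (M * G - G') <=
    M * \int[mu]_y (k x y * g y) - \int[mu]_y (k x y * g' y).
  have := comb M (- 1) x; rewrite !mulN1r; apply => y.
  by rewrite mulN1r subr_ge0; have /andP[] := gg' y.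
(* [c] is the ratio of the images under the constant kernel; the share [a / b] of
   both bounds [m] and [M] is pulled to it. *)
pose c := G' / G.
pose mm := m + a / b * (c - m); pose MM := M - a / b * (M - c).
have mc : m <= c.
  rewrite ler_pdivlMr// -RintegralZl//; apply: le_Rintegral => // y _.
  by have /andP[] := gg' y.
have cM : c <= M.
  rewrite ler_pdivrMr// -RintegralZl//; apply: le_Rintegral => // y _.
  by have /andP[] := gg' y.
have ab0 : 0 <= a / b by rewrite divr_ge0// ltW.
have ab1 : a / b <= 1.
  by rewrite ler_pdivrMr// mul1r (le_trans (k_ge point point)).
have mmm : m <= mm by rewrite lerDl mulr_ge0// subr_ge0.
have mm0 : 0 < mm by exact: lt_le_trans mmm.
have MMmm : MM = mm + (1 - a / b) * e * m by rewrite /MM /mm /M; ring.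
have MM0 : 0 < MM by rewrite MMmm ltr_pwDl// !mulr_ge0 ?subr_ge0// ltW.
have I' x : mm * \int[mu]_y (k x y * g y) <= \int[mu]_y (k x y * g' y)
    <= MM * \int[mu]_y (k x y * g y).
  have /andP[_ IbG] := weight_bounds x wg.
  set I := \int[mu]_y (k x y * g y) in IbG *.
  have abI : a / b * I <= a * G.
    by rewrite mulrAC -mulrA ler_pM2l// ler_pdivrMr// [G * b]mulrC.
  have cG : G' = c * G by rewrite mulfVK// gt_eqF.
  have := lowB x; have := uppB x; rewrite cG -/I -!mulrBl !mulrA => u l.
  apply/andP; split.
    have : a / b * I * (c - m) <= a * G * (c - m) by rewrite ler_wpM2r// subr_ge0.
    by rewrite /mm; lra.
  have : a / b * I * (M - c) <= a * G * (M - c) by rewrite ler_wpM2r// subr_ge0.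
  by rewrite /MM; lra.
exists MM^-1; first by rewrite invr_gt0.
move=> x; have /andP[l u] := I' x.
have I0 := kernel_integral_gt0 x wg; have I'0 := kernel_integral_gt0 x wg'.
rewrite /scaling; apply/andP; split.
  by rewrite -invfM lef_pV2 ?posrE ?mulr_gt0.
apply: (@le_trans _ _ (mm * \int[mu]_y (k x y * g y))^-1).
  by rewrite lef_pV2 ?posrE ?mulr_gt0.
rewrite invfM ler_pM2r ?invr_gt0// ler_pdivlMl// ler_pdivrMr//.
by rewrite MMmm [leRHS]mulrDl mul1r lerD2l ler_wpM2l// mulr_ge0// subr_ge0.
Qed.

End scaling.

(** * A coupling near a Sinkhorn plan *)

Section competitor.
Context d1 d2 (X : measurableType d1) (Y : measurableType d2) (R : realType).
Variables (rho : probability X R) (mu : probability Y R).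

Let icst d (T : measurableType d) (nu : probability T R) (r : R) :
  (\int[nu]_x r%:E = r%:E)%E.
Proof. by rewrite integral_cst// [X in (_ * X)%E]probability_setT mule1. Qed.

(** A density [q] with exact second marginal, and with first marginal [s] nearly
constant, becomes the density of a coupling after a small correction.  The
correction is additive; the lower bound [l] on [q] makes it multiplicative. *)
Lemma coupling_correction (q : X -> Y -> R) (s : X -> R) (l e m : R) :
  measurable_fun setT (fun z : X * Y => q z.1 z.2) ->
  0 < l -> (forall x y, l <= q x y) ->
  (forall x, (\int[mu]_y (q x y)%:E = (s x)%:E)%E) ->
  (forall y, (\int[rho]_x (q x y)%:E = 1)%E) ->
  0 <= e -> 0 < m -> (forall x, m <= s x <= m * (1 + e)) ->
  exists h : X -> Y -> R,
    [/\ measurable_fun setT (fun z : X * Y => h z.1 z.2),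
        forall x y, 0 <= h x y,
        forall x, (\int[mu]_y (h x y)%:E = 1)%E,
        forall y, (\int[rho]_x (h x y)%:E = 1)%E &
        forall x y, h x y <= (1 + 2 * e / l) * q x y].
Proof.
move=> mq l0 lq qs q1 e0 m0 sb.
have mEq : measurable_fun setT (EFin \o (fun z : X * Y => q z.1 z.2)).
  exact/measurable_EFinP.
have q0 x y : 0 <= q x y by rewrite (le_trans (ltW l0)).
have mqx x : measurable_fun setT (q x).
  exact: (measurableT_comp mq (pair1_measurable x)).
have mqy y : measurable_fun setT (q ^~ y).
  exact: (measurableT_comp mq (pair2_measurable y)).
have ms : measurable_fun setT s.
  apply/measurable_EFinP.
  have -> : EFin \o s = fubini_F mu (EFin \o (fun z : X * Y => q z.1 z.2)).
    by apply/funext => x; rewrite /fubini_F /= qs.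
  by apply: measurable_fun_fubini_tonelli_F => // z; rewrite lee_fin.
have s1 : (\int[rho]_x (s x)%:E = 1)%E.
  under eq_integral do rewrite -qs.
  have := @fubini_tonelli _ _ X Y R rho mu (fun z => (q z.1 z.2)%:E) mEq.
  move=> ->; last by move=> z; rewrite lee_fin.
  by under eq_integral do rewrite /= q1; exact: icst.
have s0 x : 0 <= s x by have /andP[+ _] := sb x; exact: le_trans (ltW m0).
have m1 : m <= 1.
  rewrite -lee_fin -s1 -(icst rho m); apply: ge0_le_integral => //.
  - by move=> x _; rewrite lee_fin ltW.
  - exact/measurable_EFinP.
  - by move=> x _; rewrite lee_fin; have /andP[] := sb x.
have M1 : 1 <= m * (1 + e).
  rewrite -lee_fin -s1 -(icst rho (m * (1 + e))); apply: ge0_le_integral => //.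
  - by move=> x _; rewrite lee_fin.
  - exact/measurable_EFinP.
  - by move=> x _; rewrite lee_fin; have /andP[] := sb x.
have e1 : 0 < 1 + e by rewrite ltr_pwDl.
pose c := (1 + e)^-1.
have c0 : 0 < c by rewrite invr_gt0.
have ce : c * (1 + e) = 1 by rewrite mulVf// gt_eqF.
have cs1 x : c * s x <= 1.
  rewrite -ce ler_pM2l//; have /andP[_ sx] := sb x.
  by rewrite (le_trans sx)// ler_piMl// ltW.
have cs2 x : 1 - c * s x <= 2 * e.
  have /andP[sx _] := sb x.
  have cm : c <= m by rewrite -[c]mulr1 -(mulfK (lt0r_neq0 e1) m) mulrC ler_pM2r.
  have : c * c <= c * s x by rewrite ler_pM2l// (le_trans cm).
  have : c = 1 - c * e by rewrite -ce; ring.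
  have : c <= 1 by rewrite -ce ler_peMr ?lerDl// ltW.
  nra.
have w0 x : 0 <= 1 - c * s x by rewrite subr_ge0.
have mw : measurable_fun setT (fun x => 1 - c * s x).
  by apply: measurable_funB => //; exact: measurable_funM.
(* The factor [c] brings the first marginal below [1].  The missing mass
   [1 - c * s x] does not depend on [y], so adding it repairs the first marginal,
   and the second one as well because [s] has integral [1]. *)
exists (fun x y => c * q x y + (1 - c * s x)); split.
- apply: measurable_funD; first exact: measurable_funM.
  exact: (measurableT_comp mw).
- by move=> x y; rewrite addr_ge0// mulr_ge0// ltW.
- move=> x; under eq_integral do rewrite EFinD EFinM.
  rewrite ge0_integralD//.
  + rewrite ge0_integralZl_EFin//.
    * by rewrite qs icst -EFinM -EFinD addrC subrK.
    * by move=> y _; rewrite lee_fin.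
    * exact/measurable_EFinP.
    * exact: ltW.
  + by move=> y _; rewrite -EFinM lee_fin mulr_ge0// ltW.
  + by apply/measurable_EFinP; exact: measurable_funM.
  + by move=> y _; rewrite lee_fin.
- move=> y; under eq_integral do rewrite EFinD EFinM.
  rewrite ge0_integralD//.
  + rewrite ge0_integralZl_EFin//.
    * have -> : (\int[rho]_x (1 - c * s x)%:E = (1 - c)%:E)%E.
        have is_ : rho.-integrable setT (EFin \o s).
          apply: (@bounded_integrable _ _ _ _ _ (m * (1 + e))) => // x.
          by rewrite ger0_norm//; have /andP[] := sb x.
        have ics : rho.-integrable setT (EFin \o (fun x => c * s x)).
          exact: (integrableZl measurableT c is_).
        have i1 : rho.-integrable setT (EFin \o (fun=> 1 : R)).
          by apply: (@bounded_integrable _ _ _ _ _ 1) => // x; rewrite normr1.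
        under eq_integral do rewrite EFinB.
        rewrite (integralB measurableT i1 ics) icst.
        by rewrite (integralZl measurableT is_) s1 mule1.
      by rewrite q1 mule1 -EFinD addrC subrK.
    * by move=> x _; rewrite lee_fin.
    * exact/measurable_EFinP.
    * exact: ltW.
  + by move=> x _; rewrite -EFinM lee_fin mulr_ge0// ltW.
  + by apply/measurable_EFinP; exact: measurable_funM.
  + by move=> x _; rewrite lee_fin.
  + exact/measurable_EFinP.
- move=> x y; rewrite mulrDl mul1r lerD//.
    by rewrite ler_piMl// -ce ler_peMr ?lerDl// ltW.
  rewrite (le_trans (cs2 x))// -mulrA ler_peMr ?mulr_ge0//.
  by rewrite ler_pdivlMl// mulr1.
Qed.

End competitor.

Section sinkhorn_iteration.
Context d1 d2 (X : measurableType d1) (Y : measurableType d2) (R : realType).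
Variables (rho : probability X R) (mu : probability Y R).
Variables (k : X -> Y -> R) (a b : R).
Hypotheses (mk : measurable_fun setT (fun z : X * Y => k z.1 z.2))
  (a_gt0 : 0 < a) (k_ge : forall x y, a <= k x y)
  (k_le : forall x y, k x y <= b).
Local Notation kT := (fun y x => k x y).

(** The second marginal of the plan [u k v] is exact by definition of [v], and its
first marginal has the density [u / scaling mu k v], which is nearly constant
when one more update hardly changes [u].  The density of the plan is at least
[(a / b) ^+ 2]: normalizing costs one factor [a / b] for the kernel and one for
[u]. *)
Lemma coupling_near_plan (u : X -> R) (e : R) :
  let v := scaling rho kT u in
  weight rho u -> (forall x x', a * u x <= b * u x') ->
  0 <= e -> osc_le e u (scaling mu k v) ->
  exists h : X -> Y -> R,
    [/\ measurable_fun setT (fun z : X * Y => h z.1 z.2),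
        forall x y, 0 <= h x y,
        forall x, (\int[mu]_y (h x y)%:E = 1)%E,
        forall y, (\int[rho]_x (h x y)%:E = 1)%E &
        forall x y, h x y <= (1 + 2 * e / (a / b) ^+ 2) * (u x * k x y * v y)].
Proof.
move=> v wu har e0 [m m0 osc].
have mkT := measurable_transpose mk.
have kT_ge y x : a <= kT y x by [].
have kT_le y x : kT y x <= b by [].
have wv : weight mu v.
  exact: (scaling_weight mkT a_gt0 kT_ge kT_le).
have v0 y : 0 < v y by have [_ /(_ y)] := wv.
have u0 x : 0 < u x by have [_ /(_ x)] := wu.
have [mu_ _ _] := wu; have [mv _ _] := wv.
pose w := scaling mu k v.
have w0 x : 0 < w x.
  by have [_ /(_ x)] := scaling_weight mk a_gt0 k_ge k_le rho wv.
have b0 : 0 < b by rewrite (lt_le_trans a_gt0)// (le_trans (k_ge point point)).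
have ab0 : 0 < a / b by rewrite divr_gt0.
pose q x y := u x * k x y * v y.
have me : 0 < m * (1 + e) by rewrite mulr_gt0// ltr_pwDl.
apply: (@coupling_correction _ _ X Y R rho mu q (fun x => u x / w x)
  ((a / b) ^+ 2) e (m * (1 + e))^-1) => //.
- by apply: measurable_funM; [apply: measurable_funM => //|];
    exact: measurableT_comp.
- by rewrite exprn_gt0.
- move=> x y.
  have U0 : 0 < \int[rho]_x' (k x' y * u x').
    exact: (kernel_integral_gt0 mkT a_gt0 kT_ge kT_le y wu).
  rewrite /q /v /scaling ler_pdivlMr//.
  have /andP[_ kU] : a * \int[rho]_x' u x' <= \int[rho]_x' (k x' y * u x')
      <= b * \int[rho]_x' u x'.
    exact: (weight_bounds mkT a_gt0 kT_ge kT_le y wu).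
  have [_ _ iu] := wu.
  have aU : a * \int[rho]_x' u x' <= b * u x.
    rewrite -RintegralZl//.
    apply: (@le_trans _ _ (\int[rho]_x' (b * u x))).
      apply: le_Rintegral => //.
      - exact: (integrableZl measurableT a iu).
      - by apply: (@bounded_integrable _ _ _ _ _ `|b * u x|).
    rewrite Rintegral_cst// (_ : fine _ = 1) ?mulr1//.
    exact: (congr1 fine (probability_setT rho)).
  rewrite expr_div_n mulrAC ler_pdivrMr ?exprn_gt0//.
  apply: (@le_trans _ _ (a ^+ 2 * (b * \int[rho]_x' u x'))).
    by rewrite ler_wpM2l// exprn_ge0// ltW.
  rewrite (_ : a ^+ 2 * _ = a * b * (a * \int[rho]_x' u x')); last by ring.
  apply: (@le_trans _ _ (a * b * (b * u x))).
    by rewrite ler_wpM2l// mulr_ge0// ltW.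
  rewrite (_ : _ * (b * u x) = a * (u x * b ^+ 2)); last by ring.
  rewrite (_ : u x * _ * _ = k x y * (u x * b ^+ 2)); last by ring.
  by rewrite ler_wpM2r// mulr_ge0 ?exprn_ge0// ltW.
- move=> x; have := scaling_integral mk a_gt0 k_ge k_le x wv (ltW (u0 x)).
  by under eq_integral do rewrite mulrA.
- move=> y.
  have := scaling_integral mkT a_gt0 kT_ge kT_le y wu (ltW (v0 y)).
  rewrite -/v divff ?gt_eqF// => <-.
  by apply: eq_integral => x _; rewrite /q mulrC [u _ * _]mulrC.
- by rewrite invr_gt0.
- move=> x; have /andP[l1 l2] := osc x; have wx := w0 x.
  rewrite -/w in l1 l2; apply/andP; split.
    by rewrite ler_pdivlMr// ler_pdivrMl.
  rewrite ler_pdivrMr// invfM mulfVK ?gt_eqF ?ltr_pwDl//.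
  by rewrite ler_pdivlMl.
Qed.

End sinkhorn_iteration.

(** * Geometric convergence for kernels bounded above and below *)

Lemma scaling_ln_bounded d1 d2 (X : measurableType d1) (Y : measurableType d2)
    (R : realType) (mu : probability Y R) (k : X -> Y -> R) (a b : R) (g : Y -> R) :
  measurable_fun setT (fun z : X * Y => k z.1 z.2) -> 0 < a ->
  (forall x y, a <= k x y) -> (forall x y, k x y <= b) -> weight mu g ->
  exists M, forall x, `|ln (scaling mu k g x)| <= M.
Proof.
move=> mk a0 ka kb wg; have [lo [hi [lo0 sb]]] := scaling_bounds mk a0 ka kb wg.
exists (`|ln lo| + `|ln hi|) => x; have /andP[l h] := sb x.
have s0 : 0 < scaling mu k g x by exact: lt_le_trans l.
have hi0 : 0 < hi by exact: lt_le_trans h.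
have l' : ln lo <= ln (scaling mu k g x) by rewrite ler_ln.
have h' : ln (scaling mu k g x) <= ln hi by rewrite ler_ln.
have := ler_norm (ln hi); have := ler_norm (- ln lo); rewrite normrN => n1 n2.
have := normr_ge0 (ln hi); have := normr_ge0 (ln lo) => n3 n4.
by rewrite ler_norml; apply/andP; split; lra.
Qed.

Section geometric_convergence.
Context d1 d2 (X : measurableType d1) (Y : measurableType d2) (R : realType).
Variables (rho : probability X R) (mu : probability Y R).
Variables (k : X -> Y -> R) (a b : R).
Hypotheses (mk : measurable_fun setT (fun z : X * Y => k z.1 z.2))
  (a_gt0 : 0 < a) (k_ge : forall x y, a <= k x y)
  (k_le : forall x y, k x y <= b).
Local Notation kT := (fun y x => k x y).
Variable pi : probability (X * Y)%type R.
Local Notation gibbs gamma := (rel_entropy gamma (rho \x mu)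
  - \int[gamma]_z (ln (k z.1 z.2))%:E)%E.
Hypotheses (pi_coupling : is_coupling rho mu pi)
  (pi_optimal : forall gamma : probability (X * Y)%type R,
    is_coupling rho mu gamma -> (gibbs pi <= gibbs gamma)%E).

Lemma near_coupling_entropy_le (f : X -> R) (g : Y -> R) (h : X -> Y -> R)
    (M eps : R) (w : X * Y -> \bar R) :
  measurable_fun setT f -> measurable_fun setT g ->
  (forall x, 0 < f x) -> (forall y, 0 < g y) ->
  (forall x, `|ln (f x)| <= M) -> (forall y, `|ln (g y)| <= M) ->
  measurable_fun setT (fun z : X * Y => h z.1 z.2) ->
  (forall x y, 0 <= h x y) ->
  (forall x, (\int[mu]_y (h x y)%:E = 1)%E) ->
  (forall y, (\int[rho]_x (h x y)%:E = 1)%E) ->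
  0 <= eps -> (forall x y, h x y <= (1 + eps) * (f x * k x y * g y)) ->
  (forall z, (0 <= w z)%E) -> measurable_fun setT w ->
  {ae (rho \x mu)%E, forall z, w z = (f z.1 * k z.1 z.2 * g z.2)%:E} ->
  (rel_entropy pi (fun A => \int[(rho \x mu)]_(z in A) w z) <= eps%:E)%E.
Proof.
move=> mf mg f0 g0 fM gM mh h0 hX hY eps0 hle w0 mw wE.
have k0 x y : 0 < k x y by exact: lt_le_trans (k_ge x y).
have b0 : 0 < b := lt_le_trans (k0 point point) (k_le point point).
pose M' := M + `|ln a| + `|ln b|.
have lkM x y : `|ln (k x y)| <= `|ln a| + `|ln b|.
  have l' : ln a <= ln (k x y) by rewrite ler_ln ?posrE.
  have h' : ln (k x y) <= ln b by rewrite ler_ln ?posrE.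
  have := ler_norm (ln b); have := ler_norm (- ln a); rewrite normrN => n1 n2.
  have := normr_ge0 (ln a); have := normr_ge0 (ln b) => n3 n4.
  by rewrite ler_norml; apply/andP; split; lra.
have M0 : 0 <= M by exact: le_trans (fM point).
have lnK x y : expR (ln (f x) + ln (g y) + ln (k x y)) = f x * k x y * g y.
  by rewrite !expRD !lnK ?posrE// mulrAC.
apply: (@optimal_entropy_le _ _ X Y R rho mu pi (fun z => ln (k z.1 z.2))
  (@ln R \o f) (@ln R \o g) w (fun z => h z.1 z.2) M' eps) => //.
- exact: measurableT_comp mk.
- exact: measurableT_comp.
- exact: measurableT_comp.
- by move=> z; rewrite (le_trans (lkM _ _))// /M' -addrA lerDr.
- by move=> x; rewrite (le_trans (fM _))// /M' -addrA lerDl addr_ge0.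
- by move=> x; rewrite (le_trans (gM _))// /M' -addrA lerDl addr_ge0.
- by apply: filterS wE => z ->; rewrite /= lnK.
- by move=> z; rewrite /= lnK.
Qed.

Variable g0 : Y -> R.
Hypothesis g0_weight : weight mu g0.

Definition col_scaling n : Y -> R :=
  iter n (fun g => scaling rho kT (scaling mu k g)) g0.
Definition row_scaling n : X -> R := scaling mu k (col_scaling n).

Let mkT := measurable_transpose mk.
Let kT_ge y x : a <= kT y x. Proof. exact: k_ge. Qed.
Let kT_le y x : kT y x <= b. Proof. exact: k_le. Qed.

Lemma col_scaling_weight n : weight mu (col_scaling n).
Proof.
elim: n => [//|n ih] /=.
apply: (scaling_weight mkT a_gt0 kT_ge kT_le).
exact: (scaling_weight mk a_gt0 k_ge k_le).
Qed.

Lemma row_scaling_weight n : weight rho (row_scaling n).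
Proof. exact: (scaling_weight mk a_gt0 k_ge k_le _ (col_scaling_weight n)). Qed.

(** Half of the contraction [a / b] is given away so that the rate is positive
even when [a = b]. *)
Definition rate : R := 1 - a / b / 2.
Definition initial_osc : R := (b / a) ^+ 4.

Let b_gt0 : 0 < b.
Proof. by rewrite (lt_le_trans a_gt0)// (le_trans (k_ge point point)). Qed.

Lemma rate_itv : 0 < rate < 1.
Proof.
have ab0 : 0 < a / b by rewrite divr_gt0.
have ab1 : a / b <= 1.
  by rewrite ler_pdivrMr// mul1r (le_trans (k_ge point point)).
by rewrite /rate; apply/andP; split; lra.
Qed.

Lemma row_scaling_osc n :
  osc_le (rate ^+ n * initial_osc) (row_scaling n) (row_scaling n.+1) /\
  osc_le (rate ^+ n * initial_osc) (col_scaling n.+1) (col_scaling n.+2).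
Proof.
have /andP[r0 r1] := rate_itv.
have ab0 : 0 < a / b by rewrite divr_gt0.
have ab1 : a / b <= 1.
  by rewrite ler_pdivrMr// mul1r (le_trans (k_ge point point)).
have weaken (S : Type) (u v : S -> R) (e : R) : (forall x, 0 < u x) -> 0 <= e ->
    osc_le ((1 - a / b) * e) u v -> osc_le (rate * e) u v.
  move=> u0 e0; apply: osc_le_trans => //; rewrite ler_wpM2r// /rate; lra.
have o0 : 0 <= initial_osc by rewrite exprn_ge0// divr_ge0 ?ltW.
have rn i : 0 <= rate ^+ i * initial_osc by rewrite mulr_ge0// exprn_ge0// ltW.
have rowP i x : 0 < row_scaling i x by have [_ /(_ x)] := row_scaling_weight i.
have colP i x : 0 < col_scaling i x by have [_ /(_ x)] := col_scaling_weight i.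
have step i : osc_le (rate ^+ i * initial_osc) (row_scaling i) (row_scaling i.+1) ->
    osc_le (rate ^+ i.+1 * initial_osc) (col_scaling i.+1) (col_scaling i.+2).
  move=> H; rewrite exprS -mulrA; apply: (weaken _ _ _ _ (colP i.+1) (rn i)).
  exact: (scaling_osc mkT a_gt0 kT_ge kT_le (row_scaling_weight i)
    (row_scaling_weight i.+1) (rn i) H).
have step' i : osc_le (rate ^+ i * initial_osc) (row_scaling i) (row_scaling i.+1) ->
    osc_le (rate ^+ i * initial_osc) (col_scaling i.+1) (col_scaling i.+2).
  move/step; apply: osc_le_trans; first exact: colP.
  by rewrite exprS -mulrA ler_piMl// ltW.
suff row i : osc_le (rate ^+ i * initial_osc) (row_scaling i) (row_scaling i.+1).
  by split => //; exact: step'.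
elim: i => [|i ih].
- (* The first two iterates are compared through their values at one point, at
     the price of a factor [b / a] for each of the four estimates. *)
  rewrite expr0 mul1r.
  have H x x' := scaling_harnack mk a_gt0 k_ge k_le x x' (col_scaling_weight 0).
  have H' x x' := scaling_harnack mk a_gt0 k_ge k_le x x' (col_scaling_weight 1).
  have p0 := rowP 0 point; have p1 := rowP 1 point.
  exists ((a / b) ^+ 2 * (row_scaling 1 point / row_scaling 0 point)).
    by rewrite mulr_gt0 ?divr_gt0// exprn_gt0.
  move=> x; have px := rowP 0 x; have px1 := rowP 1 x.
  have h1 := H x point; have h2 := H point x.
  have h3 := H' x point; have h4 := H' point x.
  rewrite -/(row_scaling 0) -/(row_scaling 1) in h1 h2 h3 h4.
  have lower u v : a * u <= b * v -> a / b * u <= v.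
    by move=> uv; rewrite mulrAC ler_pdivrMr// [v * b]mulrC.
  have upper u v : a * u <= b * v -> u <= b / a * v.
    by move=> uv; rewrite mulrAC ler_pdivlMr// mulrC.
  apply/andP; split.
    rewrite mulrA mulrAC ler_pdivrMr// expr2.
    rewrite (_ : _ * row_scaling 0 x =
      (a / b * row_scaling 1 point) * (a / b * row_scaling 0 x)); last by ring.
    by apply: ler_pM; rewrite ?lower// mulr_ge0 ?ltW.
  apply: (@le_trans _ _ (b / a * row_scaling 1 point * (b / a *
      row_scaling 0 x / row_scaling 0 point))).
    apply: (@le_trans _ _ (b / a * row_scaling 1 point)); first exact: upper.
    rewrite ler_peMr//; first by rewrite ltW// mulr_gt0// divr_gt0.
    by rewrite ler_pdivlMr// mul1r upper.
  rewrite (_ : _ * _ * (_ / _) = (b / a) ^+ 2 *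
    (row_scaling 1 point / row_scaling 0 point) * row_scaling 0 x); last by ring.
  rewrite ler_pM2r// [leRHS]mulrAC ler_pM2r ?divr_gt0//.
  rewrite mulrDr mulr1 /initial_osc (_ : _ * (b / a) ^+ 4 = (b / a) ^+ 2); last first.
    by field; rewrite !gt_eqF.
  by rewrite lerDr exprn_ge0// ltW.
- rewrite exprS -mulrA; apply: (weaken _ _ _ _ (rowP i.+1) (rn i)).
  exact: (scaling_osc mk a_gt0 k_ge k_le (col_scaling_weight i.+1)
    (col_scaling_weight i.+2) (rn i) (step' i ih)).
Qed.

Definition step_bound n : R := 2 * (rate ^+ n * initial_osc) / (a / b) ^+ 2.

Let step_bound_ge0 n : 0 <= rate ^+ n * initial_osc /\ 0 <= step_bound n.
Proof.
have /andP[r0 _] := rate_itv.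
have ab0 : 0 < a / b by rewrite divr_gt0.
have o0 : 0 <= initial_osc by rewrite exprn_ge0// divr_ge0 ?ltW.
have e0 : 0 <= rate ^+ n * initial_osc by rewrite mulr_ge0// exprn_ge0// ltW.
split => //; apply: divr_ge0; first exact: mulr_ge0.
by rewrite exprn_ge0// ltW.
Qed.

Let scaling_ln_bound n : exists M,
  (forall x, `|ln (row_scaling n x)| <= M) /\
  (forall y, `|ln (col_scaling n.+1 y)| <= M).
Proof.
have [M rM] := scaling_ln_bounded mk a_gt0 k_ge k_le (col_scaling_weight n).
have [N cN] := scaling_ln_bounded mkT a_gt0 kT_ge kT_le (row_scaling_weight n).
exists (Num.max M N); split => z.
  by rewrite (le_trans (rM z))// le_max lexx.
by rewrite (le_trans (cN z))// le_max lexx orbT.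
Qed.

Lemma full_step_entropy_le n (w : X * Y -> \bar R) :
  (forall z, (0 <= w z)%E) -> measurable_fun setT w ->
  {ae (rho \x mu)%E, forall z,
    w z = (row_scaling n z.1 * k z.1 z.2 * col_scaling n.+1 z.2)%:E} ->
  (rel_entropy pi (fun A => \int[(rho \x mu)]_(z in A) w z)
     <= (step_bound n)%:E)%E.
Proof.
move=> w0 mw wE; have [e0 b0] := step_bound_ge0 n.
have [M [rM cM]] := scaling_ln_bound n.
have [mr r0 _] := row_scaling_weight n.
have [mc c0 _] := col_scaling_weight n.+1.
have [h [mh h0 hX hY hle]] := coupling_near_plan mk a_gt0 k_ge k_le
  (row_scaling_weight n)
  (fun x x' => scaling_harnack mk a_gt0 k_ge k_le x x' (col_scaling_weight n))
  e0 (row_scaling_osc n).1.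
exact: (near_coupling_entropy_le mr mc r0 c0 rM cM mh h0 hX hY b0 hle w0 mw wE).
Qed.

(** The roles of the two factors are exchanged: here it is the first marginal that
is exact, so [coupling_near_plan] is applied to the transposed kernel. *)
Lemma half_step_entropy_le n (w : X * Y -> \bar R) :
  (forall z, (0 <= w z)%E) -> measurable_fun setT w ->
  {ae (rho \x mu)%E, forall z,
    w z = (row_scaling n.+1 z.1 * k z.1 z.2 * col_scaling n.+1 z.2)%:E} ->
  (rel_entropy pi (fun A => \int[(rho \x mu)]_(z in A) w z)
     <= (step_bound n)%:E)%E.
Proof.
move=> w0 mw wE; have [e0 b0] := step_bound_ge0 n.
have [M [_ cM]] := scaling_ln_bound n; have [N [rN _]] := scaling_ln_bound n.+1.
have [mr r0 _] := row_scaling_weight n.+1.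
have [mc c0 _] := col_scaling_weight n.+1.
have [h [mh h0 hX hY hle]] := coupling_near_plan mkT a_gt0 kT_ge kT_le
  (col_scaling_weight n.+1)
  (fun y y' => scaling_harnack mkT a_gt0 kT_ge kT_le y y' (row_scaling_weight n))
  e0 (row_scaling_osc n).2.
have rMN x : `|ln (row_scaling n.+1 x)| <= Num.max M N.
  by rewrite (le_trans (rN x))// le_max lexx orbT.
have cMN y : `|ln (col_scaling n.+1 y)| <= Num.max M N.
  by rewrite (le_trans (cM y))// le_max lexx.
have hle' x y : h y x <= (1 + step_bound n) *
    (row_scaling n.+1 x * k x y * col_scaling n.+1 y).
  rewrite (le_trans (hle y x))// le_eqVlt; apply/orP; left; apply/eqP.
  by congr (_ * _); rewrite -/(row_scaling n.+1 x) mulrC mulrA [RHS]mulrAC.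
exact: (near_coupling_entropy_le (h := fun x y => h y x) mr mc r0 c0 rMN cMN
  (measurable_transpose mh) (fun x y => h0 y x) hY hX b0 hle' w0 mw wE).
Qed.

End geometric_convergence.

(** * Supports in the state space, and bounds on the kernel *)

Section state_space.
Context (R : realType) (d m : nat).
Local Notation E := (state R d m).

Let index := ('rV[rat]_d * nat * 'I_m.+1)%type.

(** A countable base of the topology, which consists of measurable sets. *)
Definition rational_box (t : index) : set E :=
  ball (map_mx ratr t.1.1 : 'rV[R]_d) t.1.2.+1%:R^-1 `*` [set t.2].

Lemma slice_open (U : set 'rV[R]_d) (i : 'I_m.+1) :
  open U -> open (U `*` [set i] : set E).
Proof.
move=> oU; rewrite openE => -[x j] [/= Ux ji]; exists (U, [set i]) => //=.
split; first exact: open_nbhs_nbhs.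
by apply/principal_filterP.
Qed.

Lemma rational_box_open t : open (rational_box t).
Proof. by apply: slice_open; exact: ball_open. Qed.

Lemma measurable_rational_box t : measurable (rational_box t).
Proof.
apply: measurableX => //.
apply: sub_sigma_algebra.
exact: ball_open.
Qed.

Lemma rational_box_basis (U : set E) p : open U -> U p ->
  exists t, rational_box t p /\ rational_box t `<=` U.
Proof.
case: p => x i oU Up.
have [[A B] /= [Ax Bi] AB] : nbhs (x, i) U by exact: open_nbhs_nbhs.
have [e /= e0 xeA] : exists2 e : R, 0 < e & ball x e `<=` A.
  exact/nbhs_ballP.
have e20 : 0 < e / 2 by rewrite divr_gt0.
have [n _ /(_ n (leqnn n)) ne] := near_infty_natSinv_lt (PosNum e20).
rewrite /= in ne.
have n0 : 0 < n.+1%:R^-1 :> R by rewrite invr_gt0.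
have /choice[c cP] : forall j : 'I_d, exists q : rat,
    `|ratr q - x 0 j| < n.+1%:R^-1.
  move=> j; have : x 0 j < x 0 j + n.+1%:R^-1 by rewrite ltrDl.
  move=> /rat_in_itvoo[q]; rewrite in_itv/= => /andP[q1 q2]; exists q.
  by rewrite gtr0_norm ?subr_gt0// ltrBlDl.
have cx : ball (map_mx ratr (\row_j c j) : 'rV[R]_d) n.+1%:R^-1 x.
  by split => // k j; rewrite ord1 !mxE /ball /= cP.
exists (\row_j c j, n, i); split => // -[y j] [/= cy ->].
apply: AB; split => /=; last exact: nbhs_singleton.
have hx := le_ball (ltW ne) cx; have hy := le_ball (ltW ne) cy.
by apply: xeA; exact: ball_splitr hx hy.
Qed.

Lemma bigcup_box (P : set index) :
  \bigcup_(t in P) rational_box t =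
  \bigcup_n (if unpickle n is Some t then
    if t \in P then rational_box t else set0 else set0).
Proof.
apply/seteqP; split=> [p [t Pt pt]|p [n _]].
  exists (pickle t); first exact: I.
  by rewrite pickleK (mem_set Pt).
case: unpickle => //= t; case: ifPn => // /set_mem Pt pt.
by exists t.
Qed.

Lemma measurable_open_state (U : set E) : open U -> measurable U.
Proof.
move=> oU.
have -> : U = \bigcup_(t in [set t | rational_box t `<=` U]) rational_box t.
  apply/seteqP; split => [p Up|p [t tU pt]]; last exact: tU.
  by have [t [tp tU]] := rational_box_basis oU Up; exists t.
rewrite bigcup_box; apply: bigcupT_measurable => n.
case: unpickle => // t; case: ifP => // _; exact: measurable_rational_box.
Qed.

(** A point off the support has a null neighbourhood, hence lies in a null box, and
there are only countably many boxes. *)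
Lemma topological_support_full (eta : probability E R) :
  measurable (topological_support eta) /\
  eta (~` topological_support eta) = 0%E.
Proof.
pose P : set index := [set t | eta (rational_box t) = 0%E].
have E1 : ~` topological_support eta = \bigcup_(t in P) rational_box t.
  apply/seteqP; split => [p /= Np|p [t Pt pt] Sp].
    have [U [oU Up U0]] : exists U : set E, [/\ open U, U p & eta U = 0%E].
      apply: contrapT => H; apply: Np => U oU Up; rewrite lt0e measure_ge0 andbT.
      by apply/eqP => U0; apply: H; exists U.
    have [t [tp tU]] := rational_box_basis oU Up; exists t => //.
    apply/eqP; rewrite -measure_le0 -U0 le_measure ?inE//.
      exact: measurable_rational_box.
    exact: measurable_open_state.
  by have := Sp _ (@rational_box_open t) pt; rewrite Pt ltxx.
have mF n : measurable (if unpickle n is Some t then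
    if t \in P then rational_box t else set0 else set0).
  by case: unpickle => // t; case: ifP => // _; exact: measurable_rational_box.
have mC : measurable (~` topological_support eta).
  by rewrite E1 bigcup_box; exact: bigcupT_measurable.
split; first by rewrite -[topological_support _]setCK; exact: measurableC.
apply/negligibleP => //; rewrite E1 bigcup_box; apply: negligible_bigcup => n.
apply/negligibleP => //; case: unpickle => [t|]; last exact: measure0.
by case: ifPn => [/set_mem //|_]; exact: measure0.
Qed.

End state_space.

Section support_bounds.
Context (R : realType) (d m : nat).
Local Notation E := (state R d m).

Lemma topological_support_component (eta : probability E R) (p : E) :
  topological_support eta p ->
  (0 < regime_mass eta p.2)%E /\
  topological_support (conditional_law eta p.2) p.1.
Proof.
case: p => x i /= etap.
have comp_gt0 U : open U -> U x -> (0 < component eta i U)%E.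
  by move=> oU Ux; apply: etap; [exact: slice_open|].
have m0 : (0 < regime_mass eta i)%E by apply: comp_gt0 => //; exact: openT.
split=> // U oU Ux; apply: mule_gt0; first exact: comp_gt0.
rewrite inve_gt0//; first by rewrite gt_eqF.
rewrite lt_eqF// /regime_mass /component ltey_eq fin_num_measure//.
exact: measurableX.
Qed.

(** Around each point of the product of the supports, [r] coincides on that product
with a continuous function that is positive at the point; compactness makes the
resulting local bounds uniform. *)
Lemma kernel_bounded_on_support (rho mu : probability E R)
    (r : 'I_m.+1 -> 'I_m.+1 -> 'rV[R]_d -> 'rV[R]_d -> R) :
  compact (topological_support rho) -> compact (topological_support mu) ->
  (forall i j, (0 < regime_mass rho i * regime_mass mu j)%E ->
    C2_on (fun q : 'rV[R]_d * 'rV[R]_d => r i j q.1 q.2)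
      (topological_support (conditional_law rho i) `*`
       topological_support (conditional_law mu j))) ->
  (forall i j, (0 < regime_mass rho i * regime_mass mu j)%E ->
    forall x y, topological_support (conditional_law rho i) x ->
      topological_support (conditional_law mu j) y -> 0 < r i j x y) ->
  exists M : R, 1 <= M /\ forall p q : E, topological_support rho p ->
    topological_support mu q -> M^-1 <= r p.2 q.2 p.1 q.1 <= M.
Proof.
move=> cr cm rC2 r0.
have cK := compact_setX cr cm.
set K := _ `*` _ in cK.
pose P (M : R) (z : E * E) := K z -> 1 <= M /\
  M^-1 <= r z.1.2 z.2.2 z.1.1 z.2.1 <= M.
have cov : forall z, K z -> \forall z' \near z & M \near (+oo : set_system R), P M z'.
  move=> [[x i] [y j]] [/= sx sy].
  have [mi sxi] := topological_support_component sx.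
  have [mj syj] := topological_support_component sy.
  have mij : (0 < regime_mass rho i * regime_mass mu j)%E by exact: mule_gt0.
  have [U [g [oU Uxy [gc _ _] gr]]] := rC2 i j mij (x, y) (conj sxi syj).
  have gxy : g (x, y) = r i j x y.
    by rewrite -gr//; apply/mem_set; split.
  have g0 : 0 < g (x, y) by rewrite gxy; exact: r0.
  pose e := g (x, y).
  have near_xy : \forall q \near (x, y), U q /\ (e / 2 < g q /\ g q < 2 * e).
    have c := gc _ Uxy; apply: filterI; first exact: open_nbhs_nbhs.
    apply: filterI.
    - by apply: (cvgr_gt e c); rewrite ltr_pdivrMr// mulr_natr mulr2n ltrDl.
    - by apply: (cvgr_lt e c); rewrite mulr_natl mulr2n ltrDl.
  have [[A B] /= [Ax By] AB] := near_xy.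
  pose M0 := 1 + 2 * e + 2 / e.
  (* The regimes are discrete, so they may be frozen near the point. *)
  exists ((A `*` [set i]) `*` (B `*` [set j]), [set M | M0 < M]) => /=.
    split; last by exists M0; split => //; exact: num_real.
    exists (A `*` [set i], B `*` [set j]) => //=.
    split; [exists (A, [set i]) => //=|exists (B, [set j]) => //=];
      by split => //; apply/principal_filterP.
  move=> [[[x' i'] [y' j']] M] /= [[[Ax' ->] [By' ->]] M0M] [/= sx' sy'].
  have [Uq [gl gu]] := AB (x', y') (conj Ax' By').
  have [_ sxi'] := topological_support_component sx'.
  have [_ syj'] := topological_support_component sy'.
  have -> : r i j x' y' = g (x', y').
    by rewrite -gr//; apply/mem_set; split.
  have e2 : 0 < 2 / e by rewrite divr_gt0.
  have M1 : 1 <= M by rewrite /M0 in M0M; rewrite /e in M0M e2; lra.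
  split => //; apply/andP; split.
    rewrite -[leRHS]invrK lef_pV2 ?posrE ?invr_gt0//; last 2 first.
      exact: lt_le_trans M1.
      by apply: lt_trans gl; rewrite divr_gt0.
    apply: (@le_trans _ _ (2 / e)).
      rewrite -[leRHS]invrK lef_pV2 ?posrE ?invr_gt0//.
        by rewrite invf_div ltW.
      by apply: lt_trans gl; rewrite divr_gt0.
    by rewrite /M0 in M0M; rewrite /e in M0M e2 *; lra.
  by rewrite /M0 in M0M; rewrite /e in M0M gu e2; lra.
have [M0 [_ /(_ (M0 + 1))]] := (compact_near_coveringP K).1 cK R _ P _ cov.
rewrite ltrDl => /(_ ltr01) PM.
have [[z Kz]|K0] := pselect (exists z, K z).
  have [M1 _] := PM z Kz Kz.
  exists (M0 + 1); split => // p q sp sq.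
  by have [_ H] := PM (p, q) (conj sp sq) (conj sp sq).
by exists 1; split => // p q sp sq; exfalso; apply: K0; exists (p, q); split.
Qed.
End support_bounds.

(** * Potentials indexed by regimes and with values in [[0, +oo]] *)

Section measurability.

Lemma measurable_fun_index d (T : measurableType d) (R : realType) (n : nat)
    (c : T -> 'I_n.+1) (F : 'I_n.+1 -> T -> R) :
  measurable_fun setT c -> (forall i, measurable_fun setT (F i)) ->
  measurable_fun setT (fun z => F (c z) z).
Proof.
move=> mc mF _ B mB; rewrite setTI.
have -> : (fun z => F (c z) z) @^-1` B =
    \bigcup_(i in setT) (c @^-1` [set i] `&` F i @^-1` B).
  apply/seteqP; split => [z Bz|z [i _ [/= <-]]//].
  by exists (c z).
apply: fin_bigcup_measurable; first exact: finite_finset.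
move=> i _; apply: measurableI.
- by rewrite -[X in measurable X]setTI; exact: mc.
- by rewrite -[X in measurable X]setTI; exact: mF.
Qed.

Lemma measurable_inve d (T : measurableType d) (R : realType) (f : T -> \bar R) :
  (forall x, (0 <= f x)%E) -> measurable_fun setT f ->
  measurable_fun setT (fun x => (f x)^-1)%E.
Proof.
move=> f0 mf.
have -> : (fun x => (f x)^-1)%E = (fun x => if (f x == 0)%E then +oo%E else
    if (f x == +oo)%E then 0%E else ((fine (f x)) `^ (-1))%:E).
  apply/funext => x; have := f0 x; case: (f x) => [r| |]//=; rewrite inver eqe.
  by case: eqP => // _ r0; rewrite powR_inv1.
apply: measurable_fun_ifT => //; first exact: measurable_fun_eqe.
apply: measurable_fun_ifT => //; first exact: measurable_fun_eqe.
apply/measurable_EFinP; apply: (measurableT_comp (measurable_powR (-1))).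
exact: measurableT_comp.
Qed.

End measurability.

Section regime_sums.
Context (R : realType) (d m : nat).
Local Notation E := (state R d m).
Local Open Scope ereal_scope.

Lemma component_integral (mu : probability E R) (j : 'I_m.+1)
    (f : 'rV[R]_d -> \bar R) :
  measurable_fun setT f -> (forall y, 0 <= f y) ->
  \int[component mu j]_y f y = \int[mu]_(q in setT `*` [set j]) f q.1.
Proof.
move=> mf f0.
have mD : measurable (setT `*` [set j] : set E) by exact: measurableX.
have -> : component mu j = pushforward (mrestr mu mD) fst.
  apply/funext => A; rewrite /component /pushforward /mrestr /=; congr (mu _).
  by apply/seteqP; split => -[x i] /= -[]// ? [].
rewrite (@ge0_integral_pushforward _ _ _ _ _ fst measurable_fst)//.
rewrite preimage_setT.
rewrite (@ge0_negligible_integral _ _ _ (mrestr mu mD) setT (~` (setT `*` [set j])))//.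
- rewrite setTD setCK.
  by apply: eq_measure_integral => A mA AD; rewrite /= /mrestr setIidl.
- exact: measurableC.
- exact: measurableT_comp.
- by move=> q _ /=.
- by rewrite /= /mrestr setICl measure0.
Qed.

Lemma sum_component_integral (mu : probability E R)
    (f : 'I_m.+1 -> 'rV[R]_d -> \bar R) :
  (forall j, measurable_fun setT (f j)) -> (forall j y, 0 <= f j y) ->
  measurable_fun setT (fun q : E => f q.2 q.1) ->
  \sum_(j < m.+1) \int[component mu j]_y f j y = \int[mu]_q f q.2 q.1.
Proof.
move=> mf f0 mF.
have ET : setT = \big[setU/set0]_(j < m.+1) (setT `*` [set j] : set E).
  rewrite -bigcup_seq; apply/seteqP; split => // -[x i] _.
  by exists i => //=; exact: mem_index_enum.
rewrite [RHS](_ : _ = \int[mu]_(q in \big[setU/set0]_(j < m.+1)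
  (setT `*` [set j] : set E)) f q.2 q.1); last by rewrite -ET.
rewrite ge0_integral_bigsetU//.
- apply: eq_bigr => j _; rewrite component_integral//.
  by apply: eq_integral => q /set_mem[_ /= <-].
- by move=> j; exact: measurableX.
- exact: index_enum_uniq.
- by move=> i j _ _ [[x k] [[_ /= <-] [_ /= <-]]].
- by rewrite -ET.
Qed.

End regime_sums.

Section extended_scaling.
Local Open Scope ereal_scope.
Context d1 d2 (X : measurableType d1) (Y : measurableType d2) (R : realType).
Variables (nu : probability Y R) (K : X -> Y -> R).
Hypotheses (mK : measurable_fun setT (fun z : X * Y => K z.1 z.2))
  (K_ge0 : forall x y, (0 <= K x y)%R).

Definition ereal_scaling (g : Y -> \bar R) (x : X) : \bar R :=
  (\int[nu]_y ((K x y)%:E * g y))^-1.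

(** The iterates may be infinite off the support [B]; on [B] they are the real
functions to which the contraction applies. *)
Definition represents d (T : measurableType d) (B : set T) (g : T -> \bar R)
    (gr : T -> R) : Prop :=
  [/\ forall y, 0 <= g y, measurable_fun setT g &
      forall y, B y -> g y = (gr y)%:E].

Lemma kernel_section_measurable g x : measurable_fun setT g ->
  measurable_fun setT (fun y => (K x y)%:E * g y).
Proof.
move=> mg; apply: emeasurable_funM => //; apply/measurable_EFinP.
exact: (measurableT_comp mK (pair1_measurable x)).
Qed.

Lemma measurable_ereal_scaling g : (forall y, 0 <= g y) ->
  measurable_fun setT g -> measurable_fun setT (ereal_scaling g).
Proof.
move=> g0 mg; apply: measurable_inve.
  by move=> x; apply: integral_ge0 => y _; rewrite mule_ge0// lee_fin.
apply: (@measurable_fun_fubini_tonelli_F _ _ X Y R nu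
  (fun z => (K z.1 z.2)%:E * g z.2)).
- apply: emeasurable_funM; first exact/measurable_EFinP.
  exact: measurableT_comp.
- by move=> z; rewrite mule_ge0// lee_fin.
Qed.

Lemma represents_scaling (A : set X) (B : set Y) (k : X -> Y -> R) (a b : R)
    (g : Y -> \bar R) (gr : Y -> R) :
  measurable_fun setT (fun z : X * Y => k z.1 z.2) -> (0 < a)%R ->
  (forall x y, a <= k x y)%R -> (forall x y, k x y <= b)%R ->
  (forall x y, A x -> B y -> K x y = k x y) ->
  measurable B -> nu (~` B) = 0 ->
  weight nu gr -> represents B g gr ->
  represents A (ereal_scaling g) (scaling nu k gr).
Proof.
move=> mk a0 ka kb kE mB nuB wg [g0 mg gE]; split.
- by move=> x; rewrite inve_ge0 integral_ge0// => y _; rewrite mule_ge0// lee_fin.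
- exact: measurable_ereal_scaling.
move=> x Ax; have [mgr gr0 igr] := wg.
have s0 : (0 < scaling nu k gr x)%R by exact: (scaling_gt0 mk a0 ka kb x wg).
have -> : ereal_scaling g x = (\int[nu]_y (1 * (k x y * gr y))%:E)^-1.
  congr (_^-1); apply: ge0_ae_eq_integral => //.
  - exact: kernel_section_measurable.
  - apply/measurable_EFinP; apply: measurable_funM => //.
    apply: measurable_funM => //.
    exact: (measurableT_comp mk (pair1_measurable x)).
  - by move=> y _; rewrite mule_ge0// lee_fin.
  - move=> y _; rewrite lee_fin mul1r mulr_ge0 ?(ltW (gr0 y))//.
    by rewrite (le_trans (ltW a0)).
  - exists (~` B); split => //; first exact: measurableC.
    move=> y /= H By; apply: H => _.
    by rewrite gE// -EFinM mul1r kE.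
rewrite (scaling_integral mk a0 ka kb x wg)// div1r inver gt_eqF.
  by rewrite invrK.
by rewrite invr_gt0.
Qed.

End extended_scaling.

Section regime_potentials.
Local Open Scope ereal_scope.
Context (R : realType) (d m : nat).
Local Notation E := (state R d m).
Variables (rho mu : probability E R).
Variable (r : 'I_m.+1 -> 'I_m.+1 -> 'rV[R]_d -> 'rV[R]_d -> R).
Hypotheses (r_ge0 : forall i j x y, (0 <= r i j x y)%R)
  (mr : forall i j, measurable_fun setT
     (fun q : 'rV[R]_d * 'rV[R]_d => r i j q.1 q.2)).

Definition kernel_of (p q : E) : R := r p.2 q.2 p.1 q.1.
Definition on_states (g : potential R d m) (q : E) : \bar R := g q.2 q.1.

Lemma measurable_kernel_of :
  measurable_fun setT (fun z : E * E => kernel_of z.1 z.2).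
Proof.
apply: (@measurable_fun_index _ _ R m (fun z : E * E => z.1.2)
  (fun i z => r i z.2.2 z.1.1 z.2.1)); first exact: measurableT_comp.
move=> i; apply: (@measurable_fun_index _ _ R m (fun z : E * E => z.2.2)
  (fun j z => r i j z.1.1 z.2.1)); first exact: measurableT_comp.
have mp : measurable_fun setT (fun z : E * E => (z.1.1, z.2.1)).
  by apply: measurable_fun_pair; exact: measurableT_comp.
by move=> j; exact: (measurableT_comp (mr i j) mp).
Qed.

Lemma on_states_section (g : potential R d m) j :
  measurable_fun setT (on_states g) -> measurable_fun setT (g j).
Proof. by move=> mg; exact: (measurableT_comp mg (pair2_measurable j)). Qed.

Lemma on_states_sinkhorn_f g : (forall q, 0 <= on_states g q) ->
  measurable_fun setT (on_states g) ->
  on_states (sinkhorn_f mu r g) = ereal_scaling mu kernel_of (on_states g).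
Proof.
move=> g0 mg; apply/funext => -[x i]; rewrite /on_states /sinkhorn_f/=.
congr (_^-1).
rewrite (@sum_component_integral _ _ _ mu (fun j y => (r i j x y)%:E * g j y))//.
- move=> j; apply: emeasurable_funM; last exact: on_states_section.
  by apply/measurable_EFinP; exact: (measurableT_comp (mr i j) (pair1_measurable x)).
- by move=> j y; rewrite mule_ge0 ?lee_fin//; exact: (g0 (y, j)).
- exact: (kernel_section_measurable measurable_kernel_of (x, i) mg).
Qed.

Lemma on_states_sinkhorn_g f : (forall p, 0 <= on_states f p) ->
  measurable_fun setT (on_states f) ->
  on_states (sinkhorn_g rho r f) =
    ereal_scaling rho (fun q p => kernel_of p q) (on_states f).
Proof.
move=> f0 mf; apply/funext => -[y j]; rewrite /on_states /sinkhorn_g/=.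
congr (_^-1).
rewrite (@sum_component_integral _ _ _ rho (fun i x => (r i j x y)%:E * f i x))//.
- move=> i; apply: emeasurable_funM; last exact: on_states_section.
  by apply/measurable_EFinP; exact: (measurableT_comp (mr i j) (pair2_measurable y)).
- by move=> i x; rewrite mule_ge0 ?lee_fin//; exact: (f0 (x, i)).
- exact: (kernel_section_measurable (K := fun q p => kernel_of p q)
    (measurable_transpose measurable_kernel_of) (y, j) mf).
Qed.

End regime_potentials.

(** * Kernels bounded on sets of full measure *)

Section carriers.
Local Open Scope ereal_scope.
Context d1 d2 (X : measurableType d1) (Y : measurableType d2) (R : realType).
Variables (rho : probability X R) (mu : probability Y R).

Lemma product_is_coupling : is_coupling rho mu (rho \x mu).
Proof.
split=> [A mA|B mB].
- rewrite product_measure1E// -[RHS]mule1; congr (_ * _).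
  exact: probability_setT mu.
- rewrite product_measure1E// -[RHS]mul1e; congr (_ * _).
  exact: probability_setT rho.
Qed.

Lemma coupling_ae (A : set X) (B : set Y)
    (gamma : {measure set (X * Y)%type -> \bar R}) :
  measurable A -> rho (~` A) = 0 -> measurable B -> mu (~` B) = 0 ->
  is_coupling rho mu gamma -> {ae gamma, forall z, A z.1 /\ B z.2}.
Proof.
move=> mA A0 mB B0 [c1 c2].
have h1 : {ae gamma, forall z, A z.1}.
  exists ((~` A) `*` setT); split.
  - by apply: measurableX => //; exact: measurableC.
  - by rewrite c1//; exact: measurableC.
  - by move=> z /= Az; split.
have h2 : {ae gamma, forall z, B z.2}.
  exists (setT `*` (~` B)); split.
  - by apply: measurableX => //; exact: measurableC.
  - by rewrite c2//; exact: measurableC.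
  - by move=> z /= Bz; split.
by apply: filterS2 h1 h2 => z.
Qed.

Variables (K : X -> Y -> R) (A : set X) (B : set Y) (M : R).
Hypotheses (mK : measurable_fun setT (fun z : X * Y => K z.1 z.2))
  (K_ge0 : forall x y, (0 <= K x y)%R) (M_ge1 : (1 <= M)%R)
  (K_bound : forall x y, A x -> B y -> (M^-1 <= K x y <= M)%R)
  (mA : measurable A) (A_full : rho (~` A) = 0)
  (mB : measurable B) (B_full : mu (~` B) = 0).

(** Off [A `*` B] the kernel may vanish or be unbounded.  That set is null for every
coupling, so a constant within the bounds can be put there instead. *)
Definition truncated_kernel x y : R :=
  if (x, y) \in A `*` B then K x y else 1%R.

Lemma truncated_kernelE x y : A x -> B y -> truncated_kernel x y = K x y.
Proof. by move=> Ax By; rewrite /truncated_kernel mem_set. Qed.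

Lemma truncated_kernel_bounds x y : (M^-1 <= truncated_kernel x y <= M)%R.
Proof.
rewrite /truncated_kernel; case: ifPn => [/set_mem[/= Ax By]|_].
  exact: K_bound.
by rewrite M_ge1 invf_le1 ?M_ge1// (lt_le_trans ltr01).
Qed.

Lemma measurable_truncated_kernel :
  measurable_fun setT (fun z : X * Y => truncated_kernel z.1 z.2).
Proof.
rewrite (_ : (fun z => _) = (fun z : X * Y =>
  if z \in A `*` B then K z.1 z.2 else 1%R)); last by apply/funext => -[].
apply: measurable_fun_ifT => //.
apply: (measurable_fun_bool true); rewrite setTI preimage_mem_true.
exact: measurableX.
Qed.

(** If [g] had infinite integral, the normalizing factor would vanish on [A], and
so would the plan; but no probability is absolutely continuous with respect to
the zero measure. *)
Lemma weight_of_finite_entropy (pi : probability (X * Y)%type R) (g : Y -> R) :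
  measurable_fun setT g -> (forall y, 0 < g y)%R ->
  rel_entropy pi (fun C => \int[(rho \x mu)]_(z in C)
    (ereal_scaling mu K (EFin \o g) z.1 * (K z.1 z.2)%:E * (g z.2)%:E)) < +oo ->
  weight mu g.
Proof.
move=> mg g0 ent; split => //; apply/integrableP.
have mEg : measurable_fun setT (EFin \o g) by exact/measurable_EFinP.
split=> //; under eq_integral do rewrite gee0_abs ?lee_fin ?ltW//.
rewrite ltey; apply/eqP => gI; move: ent; rewrite /rel_entropy.
case: asboolP => // dom _.
have M0 : (0 < M^-1)%R by rewrite invr_gt0 (lt_le_trans ltr01).
have f0 x : A x -> ereal_scaling mu K (EFin \o g) x = 0.
  move=> Ax; rewrite /ereal_scaling (_ : \int[mu]_y _ = +oo) ?invey//.
  apply/eqP; rewrite -leye_eq.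
  have <- : \int[mu]_y (M^-1%:E * (g y)%:E) = +oo.
    rewrite ge0_integralZl_EFin//; [|by move=> y _; rewrite lee_fin ltW|exact: ltW].
    by rewrite gI gt0_muley// lte_fin.
  apply: ae_ge0_le_integral => //.
  - by move=> y _; rewrite mule_ge0// lee_fin ltW.
  - exact: measurable_funeM.
  - by move=> y _; rewrite mule_ge0// lee_fin// ltW.
  - exact: kernel_section_measurable.
  - exists (~` B); split => //; first exact: measurableC.
    move=> y /= H By; apply: H => _.
    apply: lee_wpmul2r; rewrite lee_fin; first exact: ltW.
    by have /andP[] := K_bound Ax By.
have mf : measurable_fun setT (ereal_scaling mu K (EFin \o g)).
  by apply: measurable_ereal_scaling => // y; rewrite lee_fin ltW.
have fge0 x : 0 <= ereal_scaling mu K (EFin \o g) x.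
  by rewrite inve_ge0 integral_ge0// => y _; rewrite mule_ge0 ?lee_fin// ltW.
suff piT : pi setT = 0.
  have := probability_setT pi; rewrite piT => /eqP.
  by rewrite eq_sym onee_eq0.
apply: (dom setT) => // C mC _.
have cp := coupling_ae mA A_full mB B_full product_is_coupling.
rewrite (ge0_ae_eq_integral _ _ (g := cst 0))//.
- by rewrite integral0.
- apply: measurable_funTS; apply: emeasurable_funM; last first.
    exact: (measurableT_comp mEg measurable_snd).
  apply: emeasurable_funM; first exact: (measurableT_comp mf measurable_fst).
  exact/measurable_EFinP.
- by move=> z _; rewrite !mule_ge0 ?lee_fin// ltW.
- by apply: filterS cp => z [Az _] _; rewrite f0// !mul0e.
Qed.

End carriers.

(** * The regime-switching Sinkhorn iteration *)

Section regime_sinkhorn.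
Context (R : realType) (d m : nat).
Local Notation E := (state R d m).
Variables (rho mu : probability E R).
Variable (r : 'I_m.+1 -> 'I_m.+1 -> 'rV[R]_d -> 'rV[R]_d -> R).
Hypotheses (r_ge0 : forall i j x y, 0 <= r i j x y)
  (mr : forall i j, measurable_fun setT
     (fun q : 'rV[R]_d * 'rV[R]_d => r i j q.1 q.2)).
Variable M : R.
Local Notation A := (topological_support rho).
Local Notation B := (topological_support mu).
Hypotheses (M_ge1 : 1 <= M)
  (r_bound : forall p q : E, A p -> B q -> M^-1 <= kernel_of r p q <= M).

Local Notation K := (kernel_of r).
Local Notation k := (truncated_kernel K A B).

Let mA : measurable A := (topological_support_full rho).1.
Let A_full : rho (~` A) = 0%E := (topological_support_full rho).2.
Let mB : measurable B := (topological_support_full mu).1.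
Let B_full : mu (~` B) = 0%E := (topological_support_full mu).2.
Let mK := measurable_kernel_of mr.
Let mk : measurable_fun setT (fun z : E * E => k z.1 z.2) :=
  measurable_truncated_kernel mK mA mB.
Let M_gt0 : 0 < M. Proof. exact: lt_le_trans ltr01 M_ge1. Qed.
Let Mi_gt0 : 0 < M^-1. Proof. by rewrite invr_gt0. Qed.
Let k_ge p q : M^-1 <= k p q.
Proof. by have /andP[] := truncated_kernel_bounds M_ge1 r_bound p q. Qed.
Let k_le p q : k p q <= M.
Proof. by have /andP[] := truncated_kernel_bounds M_ge1 r_bound p q. Qed.

Lemma coupling_cost (gamma : probability (E * E)%type R) :
  is_coupling rho mu gamma ->
  entropic_cost rho mu r gamma = (rel_entropy gamma (rho \x mu)
    - \int[gamma]_z (ln (k z.1 z.2))%:E)%E.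
Proof.
move=> gc; congr (_ + _)%E.
have mlk : measurable_fun setT (fun z : E * E => ln (k z.1 z.2)).
  exact: measurableT_comp mk.
have ilk : gamma.-integrable setT (EFin \o (fun z : E * E => ln (k z.1 z.2))).
  apply: (@bounded_integrable _ _ _ _ _ (ln M)) => // z.
  have k0 : 0 < k z.1 z.2 by exact: lt_le_trans (k_ge _ _).
  rewrite ler_norml -lnV ?posrE// !ler_ln ?posrE// k_ge k_le//.
rewrite -integralN; last exact: integrable_add_def.
apply: ae_eq_integral => //.
- apply: measurableT_comp => //; apply: measurableT_comp (@measurable_lne R) _.
  exact/measurable_EFinP.
- by apply: measurableT_comp => //; exact/measurable_EFinP.
have := coupling_ae mA A_full mB B_full gc.
apply: filterS => z [Az Bz] _; rewrite /cost /= truncated_kernelE//.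
rewrite -/(kernel_of r z.1 z.2).
have k0 : 0 < kernel_of r z.1 z.2.
  by have /andP[+ _] := r_bound Az Bz; exact: lt_le_trans.
by case: ifPn => //; rewrite leNgt k0.
Qed.

Lemma plan_represents (f g : potential R d m) (fr gr : E -> R) :
  represents A (on_states f) fr -> represents B (on_states g) gr ->
  let w (z : E * E) := (on_states f z.1 * (kernel_of r z.1 z.2)%:E *
                        on_states g z.2)%E in
  [/\ forall z, (0 <= w z)%E, measurable_fun setT w &
      {ae (rho \x mu)%E, forall z,
        w z = (fr z.1 * k z.1 z.2 * gr z.2)%:E}].
Proof.
move=> [f0 mf fE] [g0 mg gE] w; split.
- by move=> z; rewrite !mule_ge0// lee_fin r_ge0.
- apply: emeasurable_funM; last exact: (measurableT_comp mg measurable_snd).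
  apply: emeasurable_funM; first exact: (measurableT_comp mf measurable_fst).
  exact/measurable_EFinP.
- have := coupling_ae mA A_full mB B_full (product_is_coupling rho mu).
  apply: filterS => z [Az Bz].
  by rewrite /w fE// gE// -!EFinM truncated_kernelE.
Qed.

Variables (g0 : 'I_m.+1 -> 'rV[R]_d -> R).
Hypotheses (g0_meas : forall j, measurable_fun setT (g0 j))
  (g0_gt0 : forall j y, 0 < g0 j y).
Local Notation Eg0 := (fun j y => (g0 j y)%:E).
Let g0' (q : E) := g0 q.2 q.1.

Lemma measurable_initial_potential : measurable_fun setT g0'.
Proof.
apply: (@measurable_fun_index _ _ R m (fun q : E => q.2) (fun j q => g0 j q.1)).
  exact: measurable_snd.
by move=> j; exact: (measurableT_comp (g0_meas j) measurable_fst).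
Qed.

Hypothesis g0_weight : weight mu g0'.
Local Notation col := (col_scaling rho mu k g0').
Local Notation row := (row_scaling rho mu k g0').

Lemma row_represents n :
  represents B (on_states (sinkhorn rho mu r Eg0 n)) (col n) ->
  represents A (on_states (sinkhorn_f mu r (sinkhorn rho mu r Eg0 n))) (row n).
Proof.
move=> gn; have [gn0 mgn _] := gn; rewrite on_states_sinkhorn_f//.
apply: (@represents_scaling _ _ _ _ R mu K mK _ A B k M^-1 M) => //.
- by move=> p q; exact: r_ge0.
- by move=> p q Ap Bq; rewrite truncated_kernelE.
- exact: (col_scaling_weight rho mk Mi_gt0 k_ge k_le g0_weight n).
Qed.

Lemma col_represents n :
  represents B (on_states (sinkhorn rho mu r Eg0 n)) (col n).
Proof.
elim: n => [|n ih].
  split => //=; first by move=> q; rewrite lee_fin; exact/ltW/g0_gt0.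
  by apply/measurable_EFinP; exact: measurable_initial_potential.
have fn := row_represents ih; have [fn0 mfn _] := fn.
rewrite /= on_states_sinkhorn_g//.
apply: (@represents_scaling _ _ _ _ R rho (fun q p => K p q) (measurable_transpose mK) _ B A
  (fun q p => k p q) M^-1 M) => //.
- by move=> p q; exact: r_ge0.
- exact: measurable_transpose mk.
- by move=> q p Bq Ap; rewrite truncated_kernelE.
- exact: (row_scaling_weight rho mk Mi_gt0 k_ge k_le g0_weight n).
Qed.

End regime_sinkhorn.

Theorem theorem2p12 (R : realType) (d m : nat) (T : R)
    (d_ge1 : (1 <= d)%N) (T_gt0 : 0 < T)
    (b : 'I_m.+1 -> R -> 'rV[R]_d -> 'rV[R]_d)
    (sigma : 'I_m.+1 -> R -> 'rV[R]_d -> 'M[R]_d)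
    (lambda : 'I_m.+1 -> 'I_m.+1 -> R -> 'rV[R]_d -> R)
    (p : R -> R -> R.-pker (state R d m) ~> (state R d m))
    (P : probability (path_space d m T) R)
    (reference : is_reference_process P p b sigma lambda)
    (rho mu : probability (state R d m) R)
    (entropy_fin :
      (rel_entropy (rho \x mu)%E (endpoint_law P) < +oo)%E)
    (endpoint_ac :
      (fun A => endpoint_law P (A `&` topological_support (rho \x mu)%E))
        `<< (rho \x mu)%E)
    (rho_ac : forall i, (0 < regime_mass rho i)%E ->
      conditional_law rho i `<< @lebesgue_rV R d)
    (mu_ac : forall j, (0 < regime_mass mu j)%E ->
      conditional_law mu j `<< @lebesgue_rV R d)
    (rho_compact : compact (topological_support rho))
    (mu_compact : compact (topological_support mu))
    (C_mu : R) (C_mu_gt0 : 0 < C_mu)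
    (talagrand : forall i, (0 < regime_mass mu i)%E ->
      forall eta : probability 'rV[R]_d R,
        (wasserstein2 eta (conditional_law mu i) ^+ 2
           <= C_mu%:E * rel_entropy eta (conditional_law mu i))%E)
    (r : 'I_m.+1 -> 'I_m.+1 -> 'rV[R]_d -> 'rV[R]_d -> R)
    (r_density : is_transition_density T p r)
    (r_C2 : forall i j, (0 < regime_mass rho i * regime_mass mu j)%E ->
      C2_on (fun q : 'rV[R]_d * 'rV[R]_d => r i j q.1 q.2)
        (topological_support (conditional_law rho i) `*` topological_support (conditional_law mu j)))
    (r_gt0 : forall i j, (0 < regime_mass rho i * regime_mass mu j)%E ->
      forall x y, topological_support (conditional_law rho i) x ->
        topological_support (conditional_law mu j) y -> 0 < r i j x y)
    (pi : probability (state R d m * state R d m)%type R)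
    (pi_optimal : is_optimal_coupling rho mu r pi)
    (g0 : 'I_m.+1 -> 'rV[R]_d -> R)
    (g0_meas : forall j, measurable_fun setT (g0 j))
    (g0_gt0 : forall j y, 0 < g0 j y)
    (half_fin :
      (rel_entropy pi (half_step rho mu r (fun j y => (g0 j y)%:E) 0) < +oo)%E)
    (full_fin :
      (rel_entropy pi (full_step rho mu r (fun j y => (g0 j y)%:E) 0) < +oo)%E) :
  exists C theta : R,
    [/\ 0 < C, 0 < theta, theta < 1 &
      forall n : nat,
        (rel_entropy pi (half_step rho mu r (fun j y => (g0 j y)%:E) n)
           <= (C * theta ^+ n)%:E)%E /\
        (rel_entropy pi (full_step rho mu r (fun j y => (g0 j y)%:E) n)
           <= (C * theta ^+ n)%:E)%E].
Proof.
have [r0 mr _] := r_density.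
have [M [M1 rM]] := kernel_bounded_on_support rho_compact mu_compact r_C2 r_gt0.
have mA := (topological_support_full rho).1.
have A_full := (topological_support_full rho).2.
have mB := (topological_support_full mu).1.
have B_full := (topological_support_full mu).2.
have mK := measurable_kernel_of mr.
pose A := topological_support rho; pose B := topological_support mu.
pose k := truncated_kernel (kernel_of r) A B.
pose g0' (q : state R d m) := g0 q.2 q.1.
have g0'_gt0 q : 0 < g0' q by exact: g0_gt0.
have K0 x y : 0 <= kernel_of r x y by exact: r0.
have mg0' := measurable_initial_potential g0_meas.
pose Eg0 := fun j y => (g0 j y)%:E.
have Eg0_ge0 q : (0 <= on_states Eg0 q)%E by rewrite lee_fin ltW.
have mEg0 : measurable_fun setT (on_states Eg0) by exact/measurable_EFinP.
have wg : weight mu g0'.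
  apply: (weight_of_finite_entropy mK K0 M1 rM mA A_full mB B_full (pi := pi)
    mg0' g0'_gt0).
  move: half_fin; rewrite /half_step /plan /= => half.
  have fE := on_states_sinkhorn_f mu r0 mr Eg0_ge0 mEg0.
  have fE' (x : state R d m) :
      sinkhorn_f mu r Eg0 x.2 x.1 = ereal_scaling mu (kernel_of r) (EFin \o g0') x.
    by rewrite -[LHS]/(on_states (sinkhorn_f mu r Eg0) x) fE.
  apply: le_lt_trans half; rewrite le_eqVlt; apply/orP; left; apply/eqP.
  congr rel_entropy; apply/funext => C; apply: eq_integral => z _.
  by rewrite -fE'.
have k_ge x y : M^-1 <= k x y.
  by have /andP[] := truncated_kernel_bounds M1 rM x y.
have k_le x y : k x y <= M.
  by have /andP[] := truncated_kernel_bounds M1 rM x y.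
have M0 : 0 < M^-1 by rewrite invr_gt0 (lt_le_trans ltr01).
have mk : measurable_fun setT (fun z => k z.1 z.2).
  exact: measurable_truncated_kernel mK mA mB.
have [pic popt] := pi_optimal.
have opt (gamma : probability (state R d m * state R d m)%type R) :
    is_coupling rho mu gamma ->
    (rel_entropy pi (rho \x mu) - \int[pi]_z (ln (k z.1 z.2))%:E <=
     rel_entropy gamma (rho \x mu) - \int[gamma]_z (ln (k z.1 z.2))%:E)%E.
  move=> gc; rewrite -(coupling_cost mr M1 rM pic) -(coupling_cost mr M1 rM gc).
  exact: popt.
have colR := col_represents r0 mr M1 rM g0_meas g0_gt0 wg.
have rowR n := row_represents r0 mr M1 rM wg (colR n).
have fullE n : (rel_entropy pi (full_step rho mu r Eg0 n)
    <= (step_bound M^-1 M n)%:E)%E.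
  have [w0 mw wE] := plan_represents r0 mr (rowR n) (colR n.+1).
  exact: (full_step_entropy_le mk M0 k_ge k_le pic opt wg w0 mw wE).
have halfE n : (rel_entropy pi (half_step rho mu r Eg0 n.+1)
    <= (step_bound M^-1 M n)%:E)%E.
  have [w0 mw wE] := plan_represents r0 mr (rowR n.+1) (colR n.+1).
  exact: (half_step_entropy_le mk M0 k_ge k_le pic opt wg w0 mw wE).
pose theta := rate M^-1 M.
have /andP[th0 th1] : 0 < theta < 1 := rate_itv M0 k_ge k_le.
pose S := step_bound M^-1 M 0.
have S_ge0 : 0 <= S.
  rewrite /S /step_bound expr0 mul1r /initial_osc.
  have Mp : 0 < M by exact: lt_le_trans ltr01 M1.
  by rewrite divr_ge0 ?mulr_ge0 ?exprn_ge0 ?divr_ge0 ?invr_ge0 ?ltW.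
have boundE n : step_bound M^-1 M n = S * theta ^+ n.
  by rewrite /S /step_bound expr0 mul1r -/theta; ring.
pose H0 := fine (rel_entropy pi (half_step rho mu r Eg0 0)).
have H0E : (rel_entropy pi (half_step rho mu r Eg0 0) <= `|H0|%:E)%E.
  move: half_fin; rewrite -/Eg0 /H0.
  case: rel_entropy => [h| |] //= _; last by rewrite leNye.
  by rewrite lee_fin ler_norm.
have n0 := normr_ge0 H0.
have St0 : 0 <= S / theta by rewrite divr_ge0// ltW.
(* [H0] pays for the half-step of index 0, and [S / theta] for the index shift
   between the other half-steps and the full steps. *)
exists (`|H0| + S + S / theta + 1), theta; split => //; first lra.
move=> n; have tn : 0 < theta ^+ n by rewrite exprn_gt0.
split; last first.
  apply: le_trans (fullE n) _; rewrite lee_fin boundE ler_pM2r//; lra.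
case: n tn => [_|n _].
  apply: le_trans H0E _; rewrite lee_fin expr0 mulr1; lra.
apply: le_trans (halfE n) _; rewrite lee_fin boundE exprS mulrA ler_pM2r ?exprn_gt0//.
apply: (@le_trans _ _ (S / theta * theta)); first by rewrite mulfVK ?gt_eqF.
by rewrite ler_pM2r//; lra.
Qed.
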